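(* For $n\ge 1$ the cyclohedron $W_n$ is homeomorphic to the closed disc $D^{n-1}$, and the cyclohedra assemble to a functor $\mathcal{W}:(\mathbf{\Delta}C_+)_{\mathcal{K}}^{op}\to \mathcal{T}\!\mathit{op}$ of categories enriched over $\mathcal{T}\!\mathit{op}$; that is, the spaces $\mathcal{W}(S)$, for $S$ a finite cyclically ordered set, together with the substitution maps $\mathcal{W}(T)\times\mathcal{K}[f]\to\mathcal{W}(S)$ for $f:S\to T$ in $\mathbf{\Delta}C_+$, define such a functor.
   Context: $\mathcal{T}\!\mathit{op}$ is the category of compactly generated weak Hausdorff spaces. For a poset $Q$, $|Q|$ denotes the geometric realization of its nerve; $|Q\times Q'|\cong|Q|\times|Q'|$. **Associahedra.** Let $S$ be a finite linearly ordered set. A bracket in $S$ is a set $B\subset S$ of consecutive elements with $2\le |B|<|S|$. A bracketing of $S$ is a set of brackets, any two of which are disjoint or nested. The bracketings form a poset under reverse inclusion, and $\mathcal{K}(S)$ is its realization ($K_n=\mathcal{K}(\{1,\dots,n\})$; $K_0=K_1=K_2$ is a point). For an order-preserving map $f:S\to T$ of finite linearly ordered sets write $\mathcal{K}[f]=\prod_{t\in T}\mathcal{K}(f^{-1}(t))$. The non-$\Sigma$ operad structure maps $\mathcal{K}(T)\times\mathcal{K}[f]\to\mathcal{K}(S)$ are the realizations of the maps of posets $(p,(q_t))\mapsto \{f^{-1}(C):C\in p\}\cup\{f^{-1}(t):t\in T\}\cup\bigcup_t q_t$, where sets with fewer than two elements and the set $S$ itself are discarded. **Cyclohedra.** Let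 $S$ be a finite cyclically ordered set. A bracket in $S$ is a set $B$ of cyclically consecutive elements with $|B|\ge 2$, together with a linear order of $B$ listing its elements consecutively in the cyclic order (for $|B|<|S|$ this order is determined by $B$; for $B=S$ there are $|S|$ choices). A bracketing of $S$ is a set of brackets, any two distinct members of which are either disjoint, or such that one is a list of consecutive elements in the linear order of the other (with the same order); in particular at most one bracket has underlying set $S$. The bracketings form a poset under reverse inclusion, and $\mathcal{W}(S)$ is its realization; $W_n=\mathcal{W}(S)$ for $|S|=n$ ($W_0=W_1$ is a point, $W_2$ is an interval, $W_3$ is a hexagon). **The category.** $\mathbf{\Delta}C_+$ has as objects the finite cyclically ordered sets (including $\varnothing$). A morphism $S\to T$ is a map of sets $f$ together with a linear ordering of each fiber $f^{-1}(t)$ such that the cyclic order of $S$ is obtained by concatenating the ordered fibers in the cyclic order of $T$ (fibers may be empty); fibers of a composite are ordered by concatenation. The enriched category $(\mathbf{\Delta}C_+)_{\mathcal{K}}$ has the same objects, $Hom(S,T)=\coprod_{f\in Hom_{\mathbf{\Delta}C_+}(S,T)}\mathcal{K}[f]$ with $\mathcal{K}[f]=\prod_{t\in T}\mathcal{K}(f^{-1}(t))$, and composition $\mathcal{K}[g]\times\mathcal{K}[f]\to\mathcal{K}[gf]$ (for $f:S\to T$, $g:T\to U$) given by the operad structure maps $\mathcal{K}(g^{-1}(u))\times\prod_{t\in g^{-1}(u)}\mathcal{K}(f^{-1}(t))\to\mathcal{K}((gf)^{-1}(u))$. **Substitution maps.** For $f:S\to T$ in $\mathbf{\Delta}C_+$,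 the map $\mathcal{W}(T)\times\mathcal{K}[f]\to\mathcal{W}(S)$ is the realization of the map of posets $(p,(q_t))\mapsto\{f^{-1}(C):C\in p\}\cup\{f^{-1}(t):t\in T\}\cup\bigcup_t q_t$, where $f^{-1}(C)$ is linearly ordered by concatenating the ordered fibers in the linear order of $C$, and members with fewer than two elements are discarded. (For surjective $f$ this is the inclusion of the cell given by putting parentheses around each $f^{-1}(t)$ with at least two elements; for empty fibers it deletes variables.) *)

(* Defs.v *)
From HB Require Import structures.
From mathcomp Require Import all_boot all_order all_algebra.
From mathcomp Require Import zify.
From mathcomp Require Import all_classical all_reals all_analysis.
Import Order.TTheory GRing.Theory Num.Theory.
Import numFieldNormedType.Exports.

Set Implicit Arguments.
Unset Strict Implicit.
Unset Printing Implicit Defensive.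

Local Open Scope classical_set_scope.
Local Open Scope ring_scope.

(** * Spaces *)

Definition homeomorphic (X Y : topologicalType) : Prop :=
  exists (f : X -> Y) (g : Y -> X),
    [/\ continuous f, continuous g, cancel f g & cancel g f].

Definition closed_disc (R : realType) (n : nat) : topologicalType :=
  set_type [set x : 'rV[R]_n | \sum_i x ord0 i ^+ 2 <= 1].

Definition compact_hausdorff (X : topologicalType) : Prop :=
  compact [set: X] /\ hausdorff_space X.

Definition weak_hausdorff (X : topologicalType) : Prop :=
  forall (C : topologicalType) (h : C -> X),
    compact_hausdorff C -> continuous h -> closed (range h).

Definition compactly_generated (X : topologicalType) : Prop :=
  forall A : set X,
    (forall (C : topologicalType) (h : C -> X),
       compact_hausdorff C -> continuous h -> closed (h @^-1` A)) ->
    closed A.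

Definition cgwh (X : topologicalType) : Prop :=
  compactly_generated X /\ weak_hausdorff X.

(** Continuity of [g] on the k-ification of [X].  The categorical product of
    compactly generated spaces is the k-ification of [X * Y], so the structure
    maps of an enriched category or functor are maps out of it. *)
Definition k_continuous (X Y : topologicalType) (g : X -> Y) : Prop :=
  forall (C : topologicalType) (h : C -> X),
    compact_hausdorff C -> continuous h -> continuous (g \o h).

(** * Geometric realization of finite posets *)

(** The nerve of a finite poset [P] is realized in barycentric coordinates: a
    point is a weight function on [P], of total weight 1, whose support is a
    chain, i.e. a point of the open simplex spanned by a nondegenerate simplex
    of the nerve.  As [P] is finite, the topology is that of R^P. *)
Definition realization_set (R : realType) d (P : finPOrderType d) :
    set (prod_topology (fun _ : P => R)) :=
  [set x | [/\ forall p, 0 <= x p, \sum_p x p = 1 &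
     forall p q, x p != 0 -> x q != 0 -> (p >=< q)%O]].

Definition realization (R : realType) d (P : finPOrderType d) :
  topologicalType := set_type (@realization_set R d P).

Definition weight (R : realType) d (P : finPOrderType d)
  (x : realization R P) : P -> R := sval x.

Lemma weightP (R : realType) d (P : finPOrderType d) (x : realization R P) :
  realization_set (weight x).
Proof. by case: x => x /= /set_mem. Qed.

Section RealizeMap.
Context (R : realType) (d d' : Order.disp_t).
Context (P : finPOrderType d) (Q : finPOrderType d').

Definition push_weight (phi : P -> Q) (x : P -> R) (q : Q) : R :=
  \sum_(p | phi p == q) x p.

Lemma push_weightP (phi : P -> Q) (x : P -> R) :
  {homo phi : p q / (p <= q)%O} ->
  realization_set (x : prod_topology (fun _ : P => R)) ->
  realization_set (push_weight phi x : prod_topology (fun _ : Q => R)).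
Proof.
move=> phi_mono [x0 x1 xch]; split.
- by move=> q; apply: sumr_ge0.
- by rewrite -x1 (partition_big phi xpredT).
have supp q : push_weight phi x q != 0 -> exists2 p, x p != 0 & phi p = q.
  move=> Hq; case: (pickP [pred p | (phi p == q) && (x p != 0)]) => /=.
    by move=> p /andP[/eqP <- xp]; exists p.
  move=> H; case/eqP: Hq; rewrite /push_weight big1 // => p pq.
  by move: (H p) => /=; rewrite pq => /negbFE/eqP.
move=> q q' /supp[p xp <-] /supp[p' xp' <-].
have := xch _ _ xp xp'; rewrite /Order.comparable.
by case/orP => /phi_mono ->; rewrite ?orbT.
Qed.

Definition realize_map (phi : P -> Q) (phi_mono : {homo phi : p q / (p <= q)%O})
    (x : realization R P) : realization R Q :=
  exist _ (push_weight phi (weight x))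
    (mem_set (push_weightP phi_mono (weightP x))).

End RealizeMap.

Lemma vertex_weightP (R : realType) d (P : finPOrderType d) (p : P) :
  realization_set ((fun q => (q == p)%:R) : prod_topology (fun _ : P => R)).
Proof.
split => [q||q q'] /=; first exact: ler0n.
  by rewrite (bigD1 p) //= eqxx big1 ?addr0 // => q /negPf ->.
have [->|qp] := eqVneq q p; last by rewrite eqxx.
have [->|qp] := eqVneq q' p; last by rewrite eqxx.
by rewrite comparablexx.
Qed.

Definition vertex (R : realType) d (P : finPOrderType d) (p : P) :
  realization R P :=
  exist _ (fun q => (q == p)%:R) (mem_set (vertex_weightP R p)).

Section Peel.
Context (R : realType) d (P : finPOrderType d).

Definition chain_weight (m : R) (x : P -> R) : Prop :=
  [/\ forall p, 0 <= x p, \sum_p x p = m &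
     forall p q, x p != 0 -> x q != 0 -> (p >=< q)%O].

Lemma chain_weight_least m x : chain_weight m x -> 0 < m ->
  exists p0, x p0 != 0 /\ forall p, x p != 0 -> (p0 <= p)%O.
Proof.
move=> [x0 x1 xch] m_gt0.
have [p1 xp1] : exists p, x p != 0.
  apply/existsP; apply: contraLR m_gt0 => /existsPn H.
  by rewrite -x1 big1 ?ltxx // => p _; apply/eqP; have := H p; rewrite negbK.
pose below p := #|[pred q | (x q != 0) && (q <= p)%O]|.
have [p0 xp0 p0min] := @arg_minnP _ p1 [pred p | x p != 0] below xp1.
move: xp0 => /= xp0; exists p0; split=> // p xp; have := xch _ _ xp0 xp.
rewrite /Order.comparable => /orP[//|pp0].
have [->//|neq] := eqVneq p0 p.
have := p0min _ xp; rewrite leqNgt => /negP[]; apply: proper_card.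
apply/properP; split.
  by apply/fintype.subsetP => q; rewrite !inE => /andP[-> /= /le_trans]; apply.
exists p0; rewrite !inE ?xp0 ?lexx //=.
by apply/negP => H; move: neq; rewrite eq_le H pp0.
Qed.

Lemma chain_weight_peel m x p0 (e : R) : chain_weight m x ->
  0 < e -> e <= x p0 ->
  let x' := fun p => x p - e * (p == p0)%:R in
  chain_weight (m - e) x' /\ (forall p, x' p != 0 -> x p != 0).
Proof.
move=> [x0 x1 xch] e0 ele x'.
have supp p : x' p != 0 -> x p != 0.
  rewrite /x'; have [->|_] := eqVneq p p0; last by rewrite mulr0 subr0.
  by move=> _; rewrite gt_eqF // (lt_le_trans e0).
split=> //; split.
- move=> p; rewrite /x'; have [->|_] := eqVneq p p0.
    by rewrite mulr1 subr_ge0.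
  by rewrite mulr0 subr0.
- rewrite sumrB x1 (bigD1 p0) //= eqxx mulr1 big1 ?addr0 // => p /negPf ->.
  by rewrite mulr0.
- by move=> p q /supp xp /supp; exact: xch.
Qed.

End Peel.

(** ** Products of posets *)

(** The product poset P * prod_i Q_i, ordered componentwise. *)
Definition prod_poset d (P : finPOrderType d) (I : finType) d'
  (Q : I -> finPOrderType d') : Type := (P * {dffun forall i, Q i})%type.

Fact prod_poset_display : Order.disp_t. Proof. exact: Order.Disp tt tt. Qed.

Section ProdPoset.
Context d (P : finPOrderType d) (I : finType) d' (Q : I -> finPOrderType d').

HB.instance Definition _ := Finite.on (prod_poset P Q).

Definition prod_poset_le (a b : prod_poset P Q) : bool :=
  (a.1 <= b.1)%O && [forall i, (a.2 i <= b.2 i)%O].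

Fact prod_poset_refl : reflexive prod_poset_le.
Proof. by move=> a; rewrite /prod_poset_le lexx /=; apply/forallP => i. Qed.

Fact prod_poset_anti : antisymmetric prod_poset_le.
Proof.
move=> [a u] [b v] /andP[/andP[/= ab /forallP uv] /andP[/= ba /forallP vu]].
congr pair; first by apply/le_anti; rewrite ab ba.
by apply/ffunP => i; apply/le_anti; rewrite uv vu.
Qed.

Fact prod_poset_trans : transitive prod_poset_le.
Proof.
move=> b a c /andP[ab /forallP uv] /andP[bc /forallP vw]; apply/andP; split.
  exact: le_trans ab bc.
by apply/forallP => i; exact: le_trans (uv i) (vw i).
Qed.

HB.instance Definition _ := Order.Le_isPOrder.Build prod_poset_display
  (prod_poset P Q) prod_poset_refl prod_poset_anti prod_poset_trans.

Definition prod_fst (a : prod_poset P Q) : P := a.1.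
Definition prod_comp (i : I) (a : prod_poset P Q) : Q i := a.2 i.

Lemma prod_fst_mono : {homo prod_fst : a b / (a <= b)%O}.
Proof. by move=> a b /andP[]. Qed.

Lemma prod_comp_mono i : {homo prod_comp i : a b / (a <= b)%O}.
Proof. by move=> a b /andP[_ /forallP]. Qed.

Context (R : realType).

(** The canonical map |P * prod_i Q_i| -> |P| * prod_i |Q_i|. *)
Definition realize_prod (z : realization R (prod_poset P Q)) :
    realization R P * prod_topology (fun i => realization R (Q i)) :=
  (realize_map prod_fst_mono z, fun i => realize_map (prod_comp_mono i) z).

Lemma chain_weight_prod n m (x : P -> R) (y : forall i, Q i -> R) :
  (#|[pred p | x p != 0%R]| + \sum_i #|[pred q | y i q != 0%R]| <= n)%N ->
  chain_weight m x -> (forall i, chain_weight m (y i)) ->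
  exists z : prod_poset P Q -> R,
    [/\ forall a, 0 <= z a,
       forall p, \sum_(a | a.1 == p) z a = x p,
       forall i q, \sum_(a : prod_poset P Q | a.2 i == q) z a = y i q &
       forall a b, z a != 0 -> z b != 0 -> (a >=< b)%O].
Proof.
elim: n m x y => [|n IHn] m x y len hx hy.
all: have m_ge0 : 0 <= m by case: hx => x0 <- _; exact: sumr_ge0.
all: have [m0|m_neq0] := eqVneq m 0.
1,3: exists (fun=> 0); split=> [//|p|i q|a b]; last by rewrite eqxx.
1,3: rewrite big1 //; case: hx => x0; rewrite m0 => /eqP.
1,2: by rewrite psumr_eq0 // => /allP/(_ p); rewrite mem_index_enum =>
  /(_ isT)/eqP.
1,2: rewrite big1 //; case: (hy i) => x0; rewrite m0 => /eqP.
1,2: by rewrite psumr_eq0 // => /allP/(_ q); rewrite mem_index_enum =>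
  /(_ isT)/eqP.
all: have m_gt0 : 0 < m by rewrite lt_def m_neq0.
all: have [p0 [xp0 p0min]] := chain_weight_least hx m_gt0.
  move: len; rewrite leqn0 addn_eq0 => /andP[/eqP/card0_eq/(_ p0)].
  by rewrite inE xp0.
pose q0 i := sval (cid (chain_weight_least (hy i) m_gt0)).
have q0P i : y i (q0 i) != 0 /\ forall q, y i q != 0 -> (q0 i <= q)%O.
  by rewrite /q0; case: cid.
pose h (j : option I) := if j is Some i then y i (q0 i) else x p0.
have [j _ jmin] := @arg_minP _ _ _ None xpredT h isT.
set e := h j.
have e_gt0 : 0 < e.
  rewrite /e; case: j {jmin e} => [i|] /=; rewrite lt_def.
    by case: (hy i) => y0 _ _; rewrite (q0P i).1 y0.
  by case: hx => x0 _ _; rewrite xp0 x0.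
have [hx' sx'] := chain_weight_peel hx e_gt0 (jmin None isT).
have hsy' i := chain_weight_peel (hy i) e_gt0 (jmin (Some i) isT).
pose x' p := x p - e * (p == p0)%:R.
pose y' i q := y i q - e * (q == q0 i)%:R.
have [||i|z [z0 zx zy zch]] := IHn (m - e) x' y'; first 1 last.
- exact: hx'.
- exact: (hsy' i).1.
- pose a0 : prod_poset P Q := (p0, finfun q0).
  have mono_x : forall p, x p != 0 -> (p0 <= p)%O by [].
  have z_sup a : z a != 0 -> (a0 <= a)%O.
    move=> za; have zgt : 0 < z a by rewrite lt_def za z0.
    apply/andP; split.
      apply/p0min/sx'; rewrite -/(x' _) -zx (bigD1 a) //= gt_eqF // ltr_wpDr //.
      exact: sumr_ge0.
    apply/forallP => i; rewrite /= ffunE; apply/(q0P i).2/(hsy' i).2.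
    rewrite -/(y' i _) -zy (bigD1 a) //= gt_eqF // ltr_wpDr //.
    exact: sumr_ge0.
  exists (fun a => z a + e * (a == a0)%:R); split.
  + by move=> a; rewrite addr_ge0 // mulr_ge0 // ltW.
  + move=> p; rewrite big_split /= zx /x' -[RHS](subrK (e * (p == p0)%:R)).
    congr (_ + _); rewrite -mulr_sumr; congr (_ * _).
    have [->|pp0] := eqVneq p p0.
      rewrite (bigD1 a0) //= eqxx big1 ?addr0 // => a /andP[_ /negPf ->] //.
    rewrite big1 // => a /eqP ap; case: eqP => // aa0.
    by move: pp0; rewrite -ap aa0 eqxx.
  + move=> i q; rewrite big_split /= zy /y' -[RHS](subrK (e * (q == q0 i)%:R)).
    congr (_ + _); rewrite -mulr_sumr; congr (_ * _).
    have [->|qq0] := eqVneq q (q0 i).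
      rewrite (bigD1 a0) /= ?ffunE // eqxx big1 ?addr0 //.
      by move=> a /andP[_ /negPf ->].
    rewrite big1 // => a /eqP aq; case: eqP => // aa0.
    by move: qq0; rewrite -aq aa0 /= ffunE eqxx.
  + move=> a b; have [->|aa0] := eqVneq a a0; have [->|bb0] := eqVneq b a0;
      rewrite ?comparablexx // ?mulr0 ?addr0.
    * by move=> _ /z_sup; rewrite /Order.comparable => ->.
    * by move=> /z_sup; rewrite /Order.comparable => ->; rewrite orbT.
    * exact: zch.
- rewrite -ltnS; apply: leq_trans len.
  have lex : (#|[pred p | x' p != 0%R]| <= #|[pred p | x p != 0%R]|)%N.
    by apply/subset_leq_card/fintype.subsetP => p; rewrite !inE; exact: sx'.
  have ley i : (#|[pred q | y' i q != 0%R]| <= #|[pred q | y i q != 0%R]|)%N.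
    apply/subset_leq_card/fintype.subsetP => q; rewrite !inE.
    exact: (hsy' i).2.
  case: j @e => [i|] e in e_gt0 jmin hx' sx' hsy' x' y' lex ley *.
    rewrite -addnS leq_add // (bigD1 i) //= [leqRHS](bigD1 i) //= -addSn.
    apply: leq_add; last exact: leq_sum.
    apply/proper_card/properP; split.
      by apply/fintype.subsetP => q; rewrite !inE; exact: (hsy' i).2.
    exists (q0 i); rewrite !inE ?(q0P i).1 // /y' eqxx mulr1 /e /= subrr.
    by rewrite eqxx.
  rewrite -addSn leq_add ?leq_sum //; apply/proper_card/properP; split.
    by apply/fintype.subsetP => q; rewrite !inE; exact: sx'.
  by exists p0; rewrite !inE ?xp0 // /x' eqxx mulr1 /e /= subrr eqxx.
Qed.

Lemma realize_prod_surj xy : exists z, realize_prod z = xy.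
Proof.
case: xy => [x y].
have [z [z0 zx zy zch]] := chain_weight_prod (leqnn _) (weightP x)
  (fun i => weightP (y i)).
have hz : realization_set (z : prod_topology (fun _ : prod_poset P Q => R)).
  split=> //; case: (weightP x) => _ <- _.
  rewrite (partition_big fst xpredT) //=.
  by apply: eq_bigr => p _; rewrite zx.
exists (exist _ z (mem_set hz)); congr pair.
  by apply: val_inj; apply/funext => p; exact: zx.
by apply: functional_extensionality_dep => i; apply: val_inj; apply/funext => q;
  exact: zy.
Qed.

(** The inverse of the canonical bijection |P * prod_i Q_i| ~ |P| * prod_i |Q_i|. *)
Definition realize_prod_inv
    (xy : realization R P * prod_topology (fun i => realization R (Q i))) :
    realization R (prod_poset P Q) :=
  sval (cid (realize_prod_surj xy)).

Lemma realize_prod_invK : cancel realize_prod_inv realize_prod.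
Proof. by move=> xy; rewrite /realize_prod_inv; case: cid. Qed.

Context d'' (W : finPOrderType d'').

Definition realize_map2 (phi : prod_poset P Q -> W)
    (phi_mono : {homo phi : a b / (a <= b)%O})
    (xy : realization R P * prod_topology (fun i => realization R (Q i))) :
    realization R W :=
  realize_map phi_mono (realize_prod_inv xy).

End ProdPoset.

(** * Cyclically ordered sets and the category Delta C_+ *)

Record cycSet : Type := CycSet {
  cyc_carrier :> finType;
  cyc : cyc_carrier -> cyc_carrier -> cyc_carrier -> bool;
  cyc_rot : forall x y z, cyc x y z -> cyc y z x;
  cyc_asym : forall x y z, cyc x y z -> ~~ cyc x z y;
  cyc_trans : forall x y z w, cyc x y z -> cyc x z w -> cyc x y w;
  cyc_total : forall x y z, x != y -> y != z -> z != x -> cyc x y z || cyc x z y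
}.

Definition nat_cyc (i j k : nat) : bool :=
  [|| i < j < k, j < k < i | k < i < j]%N.

(** [e] lists all elements of [S] once, in the cyclic order of [S]. *)
Definition cyc_enum (S : cycSet) (e : seq S) : bool :=
  [&& uniq e, [forall x, x \in e] &
    [forall x, forall y, forall z,
      cyc x y z == nat_cyc (index x e) (index y e) (index z e)]].

Lemma cyc_enumP (S : cycSet) (e : seq S) :
  reflect [/\ uniq e, forall x, x \in e &
    forall x y z, cyc x y z = nat_cyc (index x e) (index y e) (index z e)]
    (cyc_enum e).
Proof.
apply: (iffP and3P) => -[eU /= eA eC]; split=> //.
- by move=> x; exact: (forallP eA).
- by move=> x y z; apply/eqP; move/forallP: eC => /(_ x)/forallP/(_ y)/forallP.
- exact/forallP.
- by do 3 (apply/forallP => ?); rewrite eC.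
Qed.

Lemma cyc_enum_size (S : cycSet) (e : seq S) : cyc_enum e -> size e = #|S|.
Proof.
move=> /cyc_enumP[eU eA _]; rewrite -(card_uniqP eU); apply: eq_card => x.
by rewrite eA.
Qed.

Lemma cyc_enum_rot1 (S : cycSet) (x : S) (e : seq S) :
  cyc_enum (x :: e) -> cyc_enum (rcons e x).
Proof.
move=> /cyc_enumP[eU eA eC]; apply/cyc_enumP; split.
- by rewrite rcons_uniq.
- by move=> y; rewrite mem_rcons.
have idx y : index y (rcons e x) = if y == x then size e else index y e.
  rewrite -cats1 index_cat /= eq_sym.
  have [->|yx] := eqVneq y x; last by have := eA y; rewrite inE (negPf yx) /= => ->.
  by move: eU => /= /andP[/negPf -> _]; rewrite addn0.
have idx' y : index y (x :: e) = if y == x then 0%N else (index y e).+1.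
  by rewrite /= eq_sym.
have lt y : y != x -> (index y e < size e)%N.
  by move=> yx; rewrite index_mem; have := eA y; rewrite inE (negPf yx).
move=> a b c; rewrite eC !idx !idx' /nat_cyc.
have [|/lt ha] := eqVneq a x; have [|/lt hb] := eqVneq b x;
have [|/lt hc] := eqVneq c x; move=> *; lia.
Qed.

Lemma cyc_enum_rot (S : cycSet) (e : seq S) n : cyc_enum e -> cyc_enum (rot n e).
Proof.
move=> he; elim: n => [|n IHn]; first by rewrite rot0.
case: (ltnP n (size e)) => [lt_n|le_n]; last by rewrite rot_oversize // ltnW.
rewrite rotS //; case: (rot n e) IHn => [//|x s] xs.
by rewrite rot1_cons; exact: cyc_enum_rot1.
Qed.

Lemma cyc_enum_exists (S : cycSet) : exists e : seq S, cyc_enum e.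
Proof.
case: (pickP [pred x : S | true]) => [x0 _|S0]; last first.
  exists [::]; apply/cyc_enumP; split=> // x; by have := S0 x.
have cycxx (x y : S) : cyc x x y = false.
  by apply/negP => h; have /negP := cyc_asym (cyc_rot h); apply.
have cycxyx (x y : S) : cyc x y x = false.
  by apply/negP => /cyc_rot /cyc_rot; rewrite cycxx.
pose lt (y z : S) := ((y == x0) && (z != x0)) || cyc x0 y z.
pose le (y z : S) := (y == z) || lt y z.
have lt_tot y z : y != z -> lt y z || lt z y.
  rewrite /lt; have [->|yx] := eqVneq y x0.
    by rewrite eq_sym => ->.
  have [->|zx] := eqVneq z x0; first by rewrite orbT.
  by move=> yz; apply: cyc_total => //; rewrite eq_sym.
have lt_x0 y : lt y x0 = false.
  by rewrite /lt eqxx andbF cycxyx.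
have lt_trans y z w : lt y z -> lt z w -> lt y w.
  rewrite /lt; have [->|yx] := eqVneq y x0.
    move=> _; have [->|zx] := eqVneq z x0; rewrite ?cycxx ?cycxyx ?orbF // => /=.
    by move=> h; apply: contraL h => /eqP ->; rewrite cycxyx.
  have [->|zx] /= := eqVneq z x0; first by rewrite cycxyx.
  exact: cyc_trans.
have ltC y z : lt y z -> lt z y = false.
  rewrite /lt; have [->|yx] := eqVneq y x0.
    by rewrite cycxyx orbF andbF.
  have [->|zx] /= := eqVneq z x0; first by rewrite cycxyx.
  by move=> /cyc_asym/negPf.
have lt_cyc x y z : lt x y -> lt y z -> cyc x y z.
  have [->|xx] := eqVneq x x0.
    rewrite /lt; have [->|yx] := eqVneq y x0; first by rewrite cycxx eqxx.
    by [].
  have [->|yx] := eqVneq y x0; first by rewrite lt_x0.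
  rewrite /lt (negPf xx) (negPf yx) /= => hxy hyz.
  exact/cyc_rot/cyc_rot/(cyc_trans (cyc_rot hyz))/cyc_rot/cyc_rot.
have le_tot : total le.
  by move=> y z; rewrite /le eq_sym; have [//|/lt_tot] := eqVneq z y; rewrite orbC.
have le_trans : transitive le.
  move=> z y w /orP[/eqP -> //|yz] /orP[/eqP <-|zw]; rewrite /le ?yz ?orbT //.
  by rewrite (lt_trans _ _ _ yz zw) orbT.
pose e := sort le (enum S).
have eU : uniq e by rewrite sort_uniq enum_uniq.
have eA x : x \in e by rewrite mem_sort mem_enum.
have idxP y z : (index y e < index z e)%N = lt y z.
  have H a b : (index a e < index b e)%N -> lt a b.
    move=> ab; have := sorted_ltn_index le_trans (sort_sorted le_tot _).
    move=> /(_ (enum S) a b (eA a) (eA b) ab); rewrite /le.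
    by case/orP => // /eqP ab'; move: ab; rewrite ab' ltnn.
  apply/idP/idP => [|yz]; first exact: H.
  case: ltngtP => // [/H zy|e_yz]; first by move: (ltC _ _ yz); rewrite zy.
  have yz' : y = z by rewrite -(nth_index y (eA y)) e_yz nth_index.
  by have := ltC _ _ yz; rewrite yz' in yz *; rewrite yz.
exists e; apply/cyc_enumP; split=> // x y z; rewrite /nat_cyc !idxP.
apply/idP/idP => [h|/or3P[]/andP[h1 h2]]; last 3 first.
- exact: lt_cyc h1 h2.
- exact: cyc_rot (cyc_rot (lt_cyc _ _ _ h1 h2)).
- exact: cyc_rot (lt_cyc _ _ _ h1 h2).
have xy : x != y by apply: contraTneq h => ->; rewrite cycxx.
have yz : y != z.
  by apply: contraTneq h => ->; apply/negP => /cyc_rot; rewrite cycxx.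
have zx : z != x by apply: contraTneq h => ->; rewrite cycxyx.
have hN := negP (cyc_asym h).
case/orP: (lt_tot _ _ xy) => a1; case/orP: (lt_tot _ _ yz) => a2;
  case/orP: (lt_tot _ _ zx) => a3; rewrite ?a1 ?a2 ?a3 ?orbT //.
all: case: hN.
- exact: lt_cyc a3 a2.
- exact: cyc_rot (lt_cyc _ _ _ a1 a3).
- exact: cyc_rot (cyc_rot (lt_cyc _ _ _ a2 a1)).
- exact: cyc_rot (cyc_rot (lt_cyc _ _ _ a2 a1)).
Qed.

Lemma cyc_enum_cons (S : cycSet) (x : S) : exists e, cyc_enum (x :: e).
Proof.
have [e he] := cyc_enum_exists S; have [_ eA _] := cyc_enumP _ he.
case: (rot_to (eA x)) => i e' re; exists e'; rewrite -re.
exact: cyc_enum_rot.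
Qed.

(** A morphism [(f, F)]: [F t] is the linearly ordered fiber of [f] over [t], as a
    list.  The cyclic order of [T] is cut open into a linear list [e] to
    concatenate the fibers; such an [e] exists (lemma [cyc_enum_exists]) and is
    unique up to rotation, so the choice is immaterial. *)
Definition is_dChom (S T : cycSet)
    (fF : {ffun S -> T} * {ffun T -> seq S}) : bool :=
  [forall t, uniq (fF.2 t) && [forall s, (s \in fF.2 t) == (fF.1 s == t)]] &&
  [forall e : #|T|.-tuple T,
     cyc_enum e ==> cyc_enum (flatten [seq fF.2 t | t <- e])].

Definition dChom (S T : cycSet) : Type := {fF | @is_dChom S T fF}.

HB.instance Definition _ (S T : cycSet) := Choice.on (dChom S T).

Definition dCmap (S T : cycSet) (f : dChom S T) : S -> T := (val f).1.

Definition fib (S T : cycSet) (f : dChom S T) : T -> seq S := (val f).2.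

(** Preimage of a list of elements of [T], ordered by concatenation. *)
Definition preim_seq (S T : cycSet) (f : dChom S T) (C : seq T) : seq S :=
  flatten [seq fib f t | t <- C].

Section Hom.
Context (S T : cycSet) (f : dChom S T).

Lemma fib_uniq t : uniq (fib f t).
Proof. by case/andP: (valP f) => /forallP/(_ t)/andP[]. Qed.

Lemma mem_fib t s : (s \in fib f t) = (dCmap f s == t).
Proof.
by case/andP: (valP f) => /forallP/(_ t)/andP[_ /forallP/(_ s)/eqP].
Qed.

Lemma preim_cyc_enum (e : seq T) : cyc_enum e -> cyc_enum (preim_seq f e).
Proof.
move=> he; have /eqP sz := cyc_enum_size he.
by case/andP: (valP f) => _ /forallP/(_ (Tuple sz))/implyP/(_ he).
Qed.

Lemma mem_preim (C : seq T) s : (s \in preim_seq f C) = (dCmap f s \in C).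
Proof.
apply/flatten_mapP/idP => [[t tC]|sC]; first by rewrite mem_fib => /eqP ->.
by exists (dCmap f s) => //; rewrite mem_fib.
Qed.

Lemma preim_cat (C D : seq T) :
  preim_seq f (C ++ D) = preim_seq f C ++ preim_seq f D.
Proof. by rewrite /preim_seq map_cat flatten_cat. Qed.

Lemma preim1 t : preim_seq f [:: t] = fib f t.
Proof. by rewrite /preim_seq /= cats0. Qed.

Lemma preim_uniq (C : seq T) : uniq C -> uniq (preim_seq f C).
Proof.
elim: C => [//|t C IHC] /= /andP[tC /IHC uC].
rewrite -cat1s preim_cat preim1 cat_uniq fib_uniq uC andbT /=.
apply/hasPn => s; rewrite mem_preim mem_fib => sC.
by apply: contraNneq tC => <-.
Qed.

Lemma preim_infix (C D : seq T) :
  infix C D -> infix (preim_seq f C) (preim_seq f D).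
Proof.
by move=> /infixP[a [b ->]]; rewrite !preim_cat; exact: infix_infix.
Qed.

Lemma filter_preim (A : {pred T}) (C : seq T) :
  [seq s <- preim_seq f C | dCmap f s \in A] =
  preim_seq f [seq t <- C | t \in A].
Proof.
elim: C => [//|t C IHC]; rewrite -cat1s preim_cat filter_cat IHC preim1.
rewrite filter_cat preim_cat; congr (_ ++ _) => /=.
case: ifP => tA; rewrite ?preim1.
  by apply/all_filterP/allP => s; rewrite mem_fib => /eqP ->.
rewrite (@eq_in_filter _ _ pred0) ?filter_pred0 // => s.
by rewrite mem_fib => /eqP ->; rewrite tA.
Qed.

End Hom.

Lemma dC_id_subproof (S : cycSet) :
  is_dChom ([ffun s : S => s], [ffun s : S => [:: s]]).
Proof.
apply/andP; split; apply/forallP => /= t.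
  by rewrite ffunE /=; apply/forallP => s; rewrite ffunE inE.
apply/implyP => et; rewrite (eq_map (g := fun s => [:: s])) ?flatten_seq1 //.
by move=> s; rewrite ffunE.
Qed.

Definition dC_id (S : cycSet) : dChom S S :=
  exist _ ([ffun s => s], [ffun s => [:: s]]) (dC_id_subproof S).

Lemma dC_comp_subproof (S T U : cycSet) (g : dChom T U) (f : dChom S T) :
  is_dChom ([ffun s => dCmap g (dCmap f s)],
            [ffun u => preim_seq f (fib g u)]).
Proof.
apply/andP; split; apply/forallP => /= u.
  rewrite ffunE preim_uniq ?fib_uniq //=; apply/forallP => s.
  by rewrite ffunE mem_preim mem_fib.
apply/implyP => /(preim_cyc_enum g)/(preim_cyc_enum f).
rewrite (eq_map (ffunE _)); congr cyc_enum.
elim: (val u) => [//|v s IHs] /=.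
by rewrite -IHs -preim_cat.
Qed.

Definition dC_comp (S T U : cycSet) (g : dChom T U) (f : dChom S T) :
  dChom S U :=
  exist _ ([ffun s => dCmap g (dCmap f s)], [ffun u => preim_seq f (fib g u)])
    (dC_comp_subproof g f).

Lemma fib_comp (S T U : cycSet) (g : dChom T U) (f : dChom S T) u :
  fib (dC_comp g f) u = preim_seq f (fib g u).
Proof. by rewrite /fib /= ffunE. Qed.

(** * Associahedra *)

Fact bracketing_display : Order.disp_t. Proof. exact: Order.Disp tt tt. Qed.

(** A finite linearly ordered set is given by the list [l] of its elements; a
    set of consecutive elements is one whose elements form a contiguous sublist
    of [l]. *)
Definition lin_bracket (S : finType) (l : seq S) (B : {set S}) : bool :=
  [&& B \subset l, infix [seq s <- l | s \in B] l & (1 < #|B| < size l)%N].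

Definition disjoint_or_nested (S : finType) (B C : {set S}) : bool :=
  [|| [disjoint B & C], B \subset C | C \subset B].

Definition lin_bracketing (S : finType) (l : seq S) (p : {set {set S}}) : bool :=
  [forall B in p, lin_bracket l B] &&
  [forall B in p, forall C in p, disjoint_or_nested B C].

Definition K_poset (S : finType) (l : seq S) : Type :=
  {p : {set {set S}} | lin_bracketing l p}.

Section KPoset.
Context (S : finType) (l : seq S).

HB.instance Definition _ := Finite.on (K_poset l).

(** Bracketings are ordered by reverse inclusion. *)
Definition K_le (p q : K_poset l) : bool := val q \subset val p.

Fact K_refl : reflexive K_le.
Proof. by move=> p; rewrite /K_le. Qed.

Fact K_anti : antisymmetric K_le.
Proof. by move=> p q pq; apply/val_inj/eqP; rewrite finset.eqEsubset andbC. Qed.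

Fact K_trans : transitive K_le.
Proof. by move=> q p r qp rq; exact: fintype.subset_trans rq qp. Qed.

HB.instance Definition _ := Order.Le_isPOrder.Build bracketing_display
  (K_poset l) K_refl K_anti K_trans.

Lemma K_empty_subproof : lin_bracketing l finset.set0.
Proof. by apply/andP; split; apply/forallP => B; rewrite finset.in_set0. Qed.

Definition K_empty : K_poset l := exist _ finset.set0 K_empty_subproof.

End KPoset.

Definition assoc (R : realType) (S : finType) (l : seq S) : topologicalType :=
  realization R (K_poset l).

(** * Cyclohedra *)

(** A bracket is recorded as the list of its elements in its linear order; the
    bound [#|S|] on its length only serves to make the type finite.  It lists
    its elements consecutively in the cyclic order of [S] when it starts a list
    of [S] in cyclic order. *)
Definition cyc_bracket (S : cycSet) (b : #|S|.-bseq S) : bool :=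
  (1 < size b)%N && [exists e : #|S|.-tuple S, cyc_enum e && prefix b e].

Definition disjoint_or_infix (S : eqType) (b c : seq S) : bool :=
  [|| ~~ has [in b] c, infix b c | infix c b].

Definition cyc_bracketing (S : cycSet) (p : {set #|S|.-bseq S}) : bool :=
  [forall b in p, cyc_bracket b] &&
  [forall b in p, forall c in p, disjoint_or_infix b c].

Definition W_poset (S : cycSet) : Type :=
  {p : {set #|S|.-bseq S} | cyc_bracketing p}.

Section WPoset.
Context (S : cycSet).

HB.instance Definition _ := Finite.on (W_poset S).

(** Bracketings are ordered by reverse inclusion. *)
Definition W_le (p q : W_poset S) : bool := val q \subset val p.

Fact W_refl : reflexive W_le.
Proof. by move=> p; rewrite /W_le. Qed.

Fact W_anti : antisymmetric W_le.
Proof. by move=> p q pq; apply/val_inj/eqP; rewrite finset.eqEsubset andbC. Qed.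

Fact W_trans : transitive W_le.
Proof. by move=> q p r qp rq; exact: fintype.subset_trans rq qp. Qed.

HB.instance Definition _ := Order.Le_isPOrder.Build bracketing_display
  (W_poset S) W_refl W_anti W_trans.

End WPoset.

Definition cyclohedron (R : realType) (S : cycSet) : topologicalType :=
  realization R (W_poset S).

(** * Substitution maps *)

Lemma cyc_bracketP (S : cycSet) (b : #|S|.-bseq S) :
  reflect ((1 < size b)%N /\ exists2 e : seq S, cyc_enum e & infix b e)
    (cyc_bracket b).
Proof.
apply: (iffP andP) => -[b1 H]; split=> //.
  by case/existsP: H => e /andP[ee be]; exists (val e) => //; exact: prefixW.
case: H => e ee /infixP[u [v ev]].
have he : cyc_enum (rot (size u) e) by exact: cyc_enum_rot.
have /eqP sz := cyc_enum_size he.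
apply/existsP; exists (Tuple sz); rewrite he /= ev rot_size_cat -catA.
exact: prefix_prefix.
Qed.

Lemma cyc_bracketingP (S : cycSet) (p : {set #|S|.-bseq S}) :
  reflect ((forall b, b \in p -> cyc_bracket b) /\
    (forall b c, b \in p -> c \in p -> disjoint_or_infix b c))
    (cyc_bracketing p).
Proof.
apply: (iffP andP) => -[H1 H2]; split.
- by move=> b bp; move/forallP: H1 => /(_ b)/implyP; apply.
- move=> b c bp cp; move/forallP: H2 => /(_ b)/implyP/(_ bp)/forallP/(_ c).
  by move/implyP; apply.
- by apply/forallP => b; apply/implyP; exact: H1.
- by apply/forallP => b; apply/implyP => bp; apply/forallP => c; apply/implyP;
    exact: H2.
Qed.

Lemma lin_bracketingP (S : finType) (l : seq S) (p : {set {set S}}) :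
  reflect ((forall B, B \in p -> lin_bracket l B) /\
    (forall B C, B \in p -> C \in p -> disjoint_or_nested B C))
    (lin_bracketing l p).
Proof.
apply: (iffP andP) => -[H1 H2]; split.
- by move=> b bp; move/forallP: H1 => /(_ b)/implyP; apply.
- move=> b c bp cp; move/forallP: H2 => /(_ b)/implyP/(_ bp)/forallP/(_ c).
  by move/implyP; apply.
- by apply/forallP => b; apply/implyP; exact: H1.
- by apply/forallP => b; apply/implyP => bp; apply/forallP => c; apply/implyP;
    exact: H2.
Qed.

Lemma infix_filter (S : finType) (l : seq S) (B C : {set S}) :
  B \subset C -> infix [seq s <- l | s \in B] l ->
  infix [seq s <- l | s \in B] [seq s <- l | s \in C].
Proof.
move=> BC /infixP[u [v luv]]; set b := seq.filter _ l in luv *.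
rewrite {}luv !filter_cat (_ : [seq s <- b | s \in C] = b) ?infix_infix //.
apply/all_filterP/allP => s; rewrite mem_filter => /andP[sB _].
exact: (fintype.subsetP BC).
Qed.

Lemma disjoint_or_infixC (S : eqType) (b c : seq S) :
  disjoint_or_infix b c = disjoint_or_infix c b.
Proof. by rewrite /disjoint_or_infix has_sym orbCA orbC orbA orbC. Qed.

Lemma disjoint_or_nestedC (S : finType) (B C : {set S}) :
  disjoint_or_nested B C = disjoint_or_nested C B.
Proof. by rewrite /disjoint_or_nested disjoint_sym [in RHS]orbCA orbA orbC. Qed.

Section WSubst.
Context (S T : cycSet) (f : dChom S T).

Local Notation dom := (prod_poset (W_poset T) (fun t => K_poset (fib f t))).

(** (p, (q_t)) |-> {f^{-1}(C) : C in p} u {f^{-1}(t) : t in T} u U_t q_t, without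
    the members having fewer than two elements. *)
Definition W_subst_set (a : dom) : {set #|S|.-bseq S} :=
  finset (fun b : #|S|.-bseq S => (1 < size b)%N &&
    [|| [exists C in val a.1, b == preim_seq f C :> seq S],
        [exists t, b == fib f t :> seq S] |
        [exists t, [exists B in val (a.2 t),
           b == [seq s <- fib f t | s \in B] :> seq S]]]).

Let outer (a : dom) (C : seq T) :=
  (exists2 C' : #|T|.-bseq T, C' \in val a.1 & C = C') \/ exists t, C = [:: t].

Lemma W_subst_setP (a : dom) (b : #|S|.-bseq S) : b \in W_subst_set a ->
  (1 < size b)%N /\ ((exists2 C, outer a C & b = preim_seq f C :> seq S) \/
    exists t : T, exists2 B, B \in val (a.2 t) &
      b = [seq s <- fib f t | s \in B] :> seq S).
Proof.
rewrite finset.inE => /andP[b1 H]; split=> //; case/or3P: H.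
- case/existsP => C /andP[Cp /eqP bC]; left; exists C => //.
  by left; exists C.
- case/existsP => t /eqP bt; left; exists [:: t]; last by rewrite preim1.
  by right; exists t.
- case/existsP => t /existsP[B /andP[Bq /eqP bB]]; right; exists t.
  by exists B.
Qed.

Lemma outer_enum a C : outer a C -> exists2 e, cyc_enum e & infix C e.
Proof.
case=> [[C' C'p ->]|[t ->]].
  by have /cyc_bracketingP[/(_ _ C'p)/cyc_bracketP[]] := valP a.1.
have [e he] := cyc_enum_cons t; exists (t :: e) => //.
by rewrite infix1s mem_head.
Qed.

Lemma outer_compat a C D : outer a C -> outer a D -> disjoint_or_infix C D.
Proof.
have H1 t E : disjoint_or_infix [:: t] E.
  rewrite /disjoint_or_infix infix1s has_sym /=.
  by case: (boolP (t \in E)) => tE; rewrite ?orbT // orbF mem_seq1 in tE *.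
case=> [[C' C'p ->]|[t ->]]; last by [].
case=> [[D' D'p ->]|[t ->]]; last by rewrite disjoint_or_infixC.
by have /cyc_bracketingP[_ H] := valP a.1; exact: H.
Qed.

Lemma inner_infix (a : dom) t B : B \in val (a.2 t) ->
  infix [seq s <- fib f t | s \in B] (fib f t).
Proof.
by move=> Bq; have /lin_bracketingP[/(_ _ Bq)/and3P[]] := valP (a.2 t).
Qed.

Lemma outer_inner a C t (B : {set S}) : outer a C ->
  infix [seq s <- fib f t | s \in B] (fib f t) ->
  disjoint_or_infix [seq s <- fib f t | s \in B] (preim_seq f C).
Proof.
move=> _ Bt; rewrite /disjoint_or_infix; case: (boolP (t \in C)) => tC.
  apply/or3P; apply: Or32; apply: infix_trans Bt _.
  by rewrite -preim1 preim_infix // infix1s.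
apply/or3P; apply: Or31; apply/hasPn => s; rewrite mem_preim.
by move=> sC /=; rewrite mem_filter mem_fib; apply/andP => -[_ /eqP st];
  move: tC; rewrite -st sC.
Qed.

Lemma W_subst_subproof a : cyc_bracketing (W_subst_set a).
Proof.
apply/cyc_bracketingP; split.
  move=> b /W_subst_setP[b1 H]; apply/cyc_bracketP; split=> //.
  case: H => [[C /outer_enum[e he Ce] ->]|[t [B /inner_infix Bt ->]]].
    by exists (preim_seq f e); [exact: preim_cyc_enum|exact: preim_infix].
  have [e he] := cyc_enum_cons t.
  exists (preim_seq f (t :: e)); first exact: preim_cyc_enum.
  by apply: infix_trans Bt _; rewrite -preim1 preim_infix // infix1s mem_head.
move=> b c /W_subst_setP[_ Hb] /W_subst_setP[_ Hc].
case: Hb => [[C oC ->]|[t [B Bq ->]]]; case: Hc => [[D oD ->]|[u [B' Bq' ->]]].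
- have /or3P[CD|CD|CD] := outer_compat oC oD; apply/or3P.
  + apply: Or31; apply/hasPn => s /=; rewrite !mem_preim => sD.
    by apply: contra CD => sC; apply/hasP; exists (dCmap f s).
  + by apply: Or32; exact: preim_infix.
  + by apply: Or33; exact: preim_infix.
- by rewrite disjoint_or_infixC; apply: outer_inner oC (inner_infix Bq').
- exact: outer_inner oD (inner_infix Bq).
- have [tu|tu] := eqVneq t u; last first.
    apply/or3P; apply: Or31; apply/hasPn => s /=.
    rewrite !mem_filter !mem_fib => /andP[_ /eqP su]; apply/andP => -[_ /eqP st].
    by move: tu; rewrite -st su eqxx.
  subst u.
  have /lin_bracketingP[_ /(_ _ _ Bq Bq')/or3P[BB|BB|BB]] := valP (a.2 t).
  + apply/or3P; apply: Or31; apply/hasPn => s /=.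
    rewrite !mem_filter => /andP[sB' _]; apply/andP => -[sB _].
    by move/pred0P: BB => /(_ s) /=; rewrite sB sB'.
  + by apply/or3P; apply: Or32; exact: infix_filter BB (inner_infix Bq).
  + by apply/or3P; apply: Or33; exact: infix_filter BB (inner_infix Bq').
Qed.

Definition W_subst (a : dom) : W_poset S :=
  exist _ (W_subst_set a) (W_subst_subproof a).

Lemma W_subst_mono : {homo W_subst : a b / (a <= b)%O}.
Proof.
move=> a b /andP[ab1 /forallP ab2]; apply/fintype.subsetP => c /=.
rewrite !finset.inE => /andP[-> /or3P[/existsP[C /andP[Cp cC]]|ct|H]]; apply/or3P.
- apply: Or31; apply/existsP; exists C; rewrite cC andbT.
  exact: (fintype.subsetP ab1).
- exact: Or32.
- apply: Or33; case/existsP: H => t /existsP[B /andP[Bq cB]].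
  apply/existsP; exists t; apply/existsP; exists B; rewrite cB andbT.
  exact: (fintype.subsetP (ab2 t)).
Qed.

End WSubst.

Section KSubst.
Context (S T U : cycSet) (g : dChom T U) (f : dChom S T) (u : U).

Local Notation dom := (prod_poset (K_poset (fib g u))
  (fun t : {t | t \in fib g u} => K_poset (fib f (val t)))).

(** The operad structure map K(g^{-1}(u)) * prod_(t in g^{-1}(u)) K(f^{-1}(t))
    -> K((gf)^{-1}(u)) on posets; the members having fewer than two elements and
    the whole of (gf)^{-1}(u) are discarded. *)
Definition K_subst_set (a : dom) : {set {set S}} :=
  finset (fun B : {set S} =>
    [&& (1 < #|B|)%N, B != finset (mem (fib (dC_comp g f) u)) &
    [|| [exists C in val a.1, B == dCmap f @^-1: C],
        [exists t in fib g u, B == finset (mem (fib f t))] |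
        [exists t, B \in val (a.2 t)]]]).

Let outer (a : dom) (C : {set T}) :=
  C \in val a.1 \/ exists2 t, t \in fib g u & C = finset.set1 t.

Lemma K_subst_setP (a : dom) (B : {set S}) : B \in K_subst_set a ->
  [/\ (1 < #|B|)%N, B != finset (mem (fib (dC_comp g f) u)) &
    (exists2 C, outer a C & B = dCmap f @^-1: C) \/
    exists t, B \in val (a.2 t)].
Proof.
rewrite finset.inE => /and3P[b1 bl H]; split=> //; case/or3P: H.
- case/existsP => C /andP[Cp /eqP bC]; left; exists C => //.
  by left.
- case/existsP => t /andP[tu /eqP ->]; left; exists (finset.set1 t).
    by right; exists t.
  by apply/setP => s; rewrite !finset.inE mem_fib.
- by case/existsP => t tB; right; exists t.
Qed.

Lemma K_outer a C : outer a C ->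
  C \subset fib g u /\ infix [seq t <- fib g u | t \in C] (fib g u).
Proof.
case=> [Cp|[t tu ->]].
  by have /lin_bracketingP[/(_ _ Cp)/and3P[]] := valP a.1.
split; first by apply/fintype.subsetP => t'; rewrite finset.inE => /eqP ->.
rewrite (eq_filter (a2 := pred1 t)); last by move=> t'; rewrite finset.inE.
by rewrite filter_pred1_uniq ?fib_uniq // infix1s.
Qed.

Lemma K_outer_compat a C D : outer a C -> outer a D -> disjoint_or_nested C D.
Proof.
have H1 t E : disjoint_or_nested (finset.set1 t) E.
  by rewrite /disjoint_or_nested finset.sub1set disjoints1; case: (t \in E).
case=> [Cp|[t _ ->]]; last by [].
case=> [Dp|[t _ ->]]; last by rewrite disjoint_or_nestedC.
by have /lin_bracketingP[_ H] := valP a.1; exact: H.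
Qed.

Lemma K_inner (a : dom) t B : B \in val (a.2 t) ->
  B \subset fib f (val t) /\
  infix [seq s <- fib f (val t) | s \in B] (fib f (val t)).
Proof.
by move=> Bq; have /lin_bracketingP[/(_ _ Bq)/and3P[]] := valP (a.2 t).
Qed.

Lemma K_outer_inner t (B : {set S}) (C : {set T}) : B \subset fib f t ->
  disjoint_or_nested B (dCmap f @^-1: C).
Proof.
move=> /fintype.subsetP Bt; rewrite /disjoint_or_nested.
case: (boolP (t \in C)) => tC; apply/or3P.
  apply: Or32; apply/fintype.subsetP => s /Bt.
  by rewrite finset.inE mem_fib => /eqP ->.
apply: Or31; apply/pred0P => s /=; apply/andP => -[/Bt].
by rewrite mem_fib finset.inE => /eqP ->; rewrite (negPf tC).
Qed.

Lemma K_subst_subproof a : lin_bracketing (fib (dC_comp g f) u) (K_subst_set a).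
Proof.
apply/lin_bracketingP; split.
  move=> B /K_subst_setP[b1 bl H].
  suff [Bl Bi] : B \subset preim_seq f (fib g u) /\
      infix [seq s <- preim_seq f (fib g u) | s \in B] (preim_seq f (fib g u)).
    rewrite /lin_bracket b1 /= fib_comp Bl Bi /=.
    rewrite -(card_uniqP _) ?preim_uniq ?fib_uniq //.
    apply: proper_card; rewrite properE Bl /=; apply: contra bl => lB.
    apply/eqP/setP => s; rewrite finset.inE fib_comp; apply/idP/idP.
      exact: (fintype.subsetP Bl).
    exact: (fintype.subsetP lB).
  case: H => [[C /K_outer[Cl Ci] ->]|[[t tu] /K_inner[/= Bt Bi]]]; split.
  - apply/fintype.subsetP => s; rewrite finset.inE mem_preim.
    exact: (fintype.subsetP Cl).
  - rewrite (eq_filter (a2 := fun s => dCmap f s \in C)); last first.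
      by move=> s; rewrite finset.inE.
    by rewrite (filter_preim f (mem C)) preim_infix.
  - apply/fintype.subsetP => s /(fintype.subsetP Bt).
    by rewrite mem_fib mem_preim => /eqP ->.
  - have tinf : infix (fib f t) (preim_seq f (fib g u)).
      by rewrite -preim1 preim_infix // infix1s.
    suff -> : [seq s <- preim_seq f (fib g u) | s \in B] =
              [seq s <- fib f t | s \in B] by exact: infix_trans Bi tinf.
    transitivity [seq s <- [seq s <- preim_seq f (fib g u) |
        dCmap f s \in pred1 t] | s \in B].
      rewrite -filter_predI; apply: eq_filter => s /=; rewrite inE.
      case: (boolP (s \in B)) => //= /(fintype.subsetP Bt).
      by rewrite mem_fib => ->.
    rewrite filter_preim (eq_filter (a2 := pred1 t)) //.
    by rewrite filter_pred1_uniq ?fib_uniq // preim1.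
move=> B B' /K_subst_setP[_ _ Hb] /K_subst_setP[_ _ Hc].
case: Hb => [[C oC ->]|[t Bq]]; case: Hc => [[D oD ->]|[t' Bq']].
- have /or3P[CD|CD|CD] := K_outer_compat oC oD; apply/or3P.
  + apply: Or31; apply/pred0P => s; rewrite /= !finset.inE.
    by move/pred0P: CD => /(_ (dCmap f s)).
  + by apply: Or32; exact: preimsetS.
  + by apply: Or33; exact: preimsetS.
- by rewrite disjoint_or_nestedC; apply: K_outer_inner (K_inner Bq').1.
- exact: K_outer_inner (K_inner Bq).1.
- have [tt'|tt'] := eqVneq t t'; last first.
    apply/or3P; apply: Or31; apply/pred0P => s /=; apply/andP => -[].
    move=> /(fintype.subsetP (K_inner Bq).1) + /(fintype.subsetP (K_inner Bq').1).
    rewrite !mem_fib => /eqP st /eqP st'; case/eqP: tt'; apply/val_inj.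
    by rewrite -st -st'.
  subst t'.
  by have /lin_bracketingP[_] := valP (a.2 t); exact.
Qed.

Definition K_subst (a : dom) : K_poset (fib (dC_comp g f) u) :=
  exist _ (K_subst_set a) (K_subst_subproof a).

Lemma K_subst_mono : {homo K_subst : a b / (a <= b)%O}.
Proof.
move=> a b /andP[ab1 /forallP ab2]; apply/fintype.subsetP => B /=.
rewrite !finset.inE => /and3P[-> -> /or3P[/existsP[C /andP[Cp BC]]|Bt|H]];
  apply/or3P.
- apply: Or31; apply/existsP; exists C; rewrite BC andbT.
  exact: (fintype.subsetP ab1).
- exact: Or32.
- apply: Or33; case/existsP: H => t Bq; apply/existsP; exists t.
  exact: (fintype.subsetP (ab2 t)).
Qed.

End KSubst.

(** * The enriched category and the functor *)

Section Enriched.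
Context (R : realType).

Definition Kfib (S T : cycSet) (f : dChom S T) : topologicalType :=
  prod_topology (fun t : T => assoc R (fib f t)).

(** The coproduct over [f] of the K[f] = prod_t K(f^{-1}(t)). *)
Definition dCK_hom (S T : cycSet) : topologicalType :=
  {f : dChom S T & Kfib f}.

Definition dCK_id (S : cycSet) : dCK_hom S S :=
  existT _ (dC_id S) (fun s => vertex R (K_empty (fib (dC_id S) s))).

Definition dCK_comp (S T U : cycSet) (g : dCK_hom T U) (f : dCK_hom S T) :
    dCK_hom S U :=
  let: existT g0 b := g in let: existT f0 a := f in
  existT _ (dC_comp g0 f0) (fun u =>
    realize_map2 (@K_subst_mono S T U g0 f0 u) (b u, fun t => a (val t))).

Definition W_act (S T : cycSet) (w : cyclohedron R T) (f : dCK_hom S T) :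
    cyclohedron R S :=
  let: existT f0 a := f in realize_map2 (@W_subst_mono S T f0) (w, a).

End Enriched.

Record is_top_category (O : Type) (hom : O -> O -> topologicalType)
    (id : forall S, hom S S)
    (comp : forall S T U, hom T U -> hom S T -> hom S U) : Prop := {
  top_hom_cgwh : forall S T, cgwh (hom S T);
  top_comp_continuous : forall S T U,
    k_continuous (fun gf : hom T U * hom S T => comp S T U gf.1 gf.2);
  top_comp_id_left : forall S T (f : hom S T), comp S T T (id T) f = f;
  top_comp_id_right : forall S T (f : hom S T), comp S S T f (id S) = f;
  top_comp_assoc : forall S T U V (h : hom U V) (g : hom T U) (f : hom S T),
    comp S U V h (comp S T U g f) = comp S T V (comp T U V h g) f
}.

(** An enriched functor from the opposite category to spaces, the maps of
    mapping spaces hom S T -> Map (F T, F S) being given by their adjoints. *)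
Record is_top_presheaf (O : Type) (hom : O -> O -> topologicalType)
    (id : forall S, hom S S)
    (comp : forall S T U, hom T U -> hom S T -> hom S U)
    (F : O -> topologicalType) (act : forall S T, F T -> hom S T -> F S) :
    Prop := {
  top_presheaf_cgwh : forall S, cgwh (F S);
  top_act_continuous : forall S T,
    k_continuous (fun wf : F T * hom S T => act S T wf.1 wf.2);
  top_act_id : forall S (w : F S), act S S w (id S) = w;
  top_act_comp : forall S T U (g : hom T U) (f : hom S T) (w : F U),
    act S U w (comp S T U g f) = act S T (act T U w g) f
}.

(* Main.v *)
(** For a connected graph on a finite vertex set [T], the poset of tubings (sets
    of pairwise compatible tubes) realizes to a disc.  A convex combination of
    tubings [p], with weights [x p], is sent to the function
    [sum_p x p * sum_(I in p) 1_I] on [T], modulo constants.  Conversely a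
    function of minimum 0 is uniquely a combination [sum_I lam I * 1_I] in which
    [I] runs over the components of its superlevel sets [{h >= s}], [lam I] being
    the length of the set of levels [s] at which [I] is such a component; and
    [lam] uniquely decomposes along a chain of tubings.  This identifies the open
    cone over the complex of nonempty tubings with R^(#|T| - 1), and a radial
    rescaling turns the realization into the unit disc.

    A bracket of a cyclically ordered set is determined by the arc of all its
    elements but the last, and two brackets are compatible exactly when their
    arcs are compatible tubes of the cycle graph, so the cyclohedron is the case
    of a cycle.

    For the enriched category and the presheaf: points of finitely many
    realizations lift to one point of the realization of the product poset, so
    the axioms reduce to identities between maps of posets. *)

From mathcomp Require Import all_boot all_order all_algebra.
From mathcomp Require Import zify.
From mathcomp Require Import all_classical all_reals all_analysis.
Require Import Defs.
Import Order.TTheory GRing.Theory Num.Theory.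
Import numFieldNormedType.Exports.

Set Implicit Arguments.
Unset Strict Implicit.
Unset Printing Implicit Defensive.

Local Open Scope classical_set_scope.
Local Open Scope ring_scope.

(** * Compact Hausdorff spaces and realizations *)

(** A closed set of [X] is compact, so its image under [f], which is its preimage under [g], is
    closed. *)
Lemma compact_hausdorff_homeomorphic (X Y : topologicalType)
    (f : X -> Y) (g : Y -> X) :
  compact [set: X] -> hausdorff_space Y -> continuous f ->
  cancel f g -> cancel g f -> continuous g.
Proof.
move=> cX hY cf fK gK; apply/continuous_closedP => A cA.
have -> : g @^-1` A = f @` A.
  apply/seteqP; split=> [y Agy|_ [x Ax <-]]; last by rewrite /preimage /= fK.
  by exists (g y).
apply: compact_closed => //; apply: continuous_compact.
  exact: continuous_subspaceT.
exact: subclosed_compact cA cX _.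
Qed.

Lemma set_type_continuous (X Y : topologicalType) (A : set Y) (f : X -> A) :
  continuous (set_val \o f) -> continuous f.
Proof.
move=> /continuousP cf; apply/continuousP => _ [B oB <-]; exact: cf.
Qed.

Lemma set_type_hausdorff (X : topologicalType) (A : set X) :
  hausdorff_space X -> hausdorff_space (set_type A).
Proof.
move=> hX x y xy; apply: val_inj; apply: hX => U V xU yV.
have cv := @initial_continuous A X set_val.
by have [z [Uz Vz]] := xy _ _ (cv x _ xU) (cv y _ yV); exists (set_val z).
Qed.

Lemma set_type_compact (X : topologicalType) (A : set X) :
  compact A -> compact [set: set_type A].
Proof.
move=> cA F FF _; pose G := (fun x : A => set_val x) @ F.
have GF : ProperFilter G by exact: fmap_proper_filter.
have [|x [Ax clx]] := cA G GF.
  suff : F [set x : A | A (set_val x)] by [].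
  by apply: filterE => -[x Ax]; exact: (set_mem Ax).
exists (exist _ x (mem_set Ax)); split=> // U V FU [B [[C oC <-] /= Cx CV]].
have [||z] := clx (set_val @` U) C.
- suff : F [set y : A | (set_val @` U) (set_val y)] by [].
  by apply: filterS FU => y Uy; exists y.
- exact: open_nbhs_nbhs.
by move=> [[w Uw <-] Cw]; exists w; split=> //; exact: CV.
Qed.

Lemma prod_topology_continuous (X : topologicalType) (I : eqType)
    (K : I -> topologicalType) (f : X -> prod_topology K) :
  (forall i, continuous (fun x => f x i)) -> continuous f.
Proof.
(* Testing convergence through a projection requires that projection to be onto; [dfwith] alters
   [f x] in coordinate [i] alone to reach any prescribed value. *)
move=> cf x; apply/cvg_sup => i; apply/cvg_image.
  apply/seteqP; split=> // y _; exists (dfwith (f x) i y) => //.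
  by rewrite dfwithin.
move=> U /(cf i x) fU; exists ((fun g : prod_topology K => g i) @^-1` U).
  exact: fU.
by apply: image_preimage; apply/seteqP; split=> // y _;
  exists (dfwith (f x) i y) => //; rewrite dfwithin.
Qed.

Lemma prod_topology_compact (I : eqType) (K : I -> topologicalType) :
  (forall i, compact [set: K i]) -> compact [set: prod_topology K].
Proof.
move=> cK; have := tychonoff cK; congr compact.
by apply/seteqP.
Qed.

Lemma pair_hausdorff (X Y : topologicalType) :
  hausdorff_space X -> hausdorff_space Y -> hausdorff_space (X * Y)%type.
Proof.
move=> hX hY [x y] [x' y'] h; congr pair.
  apply: hX => U V xU xV.
  have [||z [Uz Vz]] := h (fst @^-1` U) (fst @^-1` V); last by exists z.1.
  - exact: (@cvg_fst _ _ (nbhs x) (nbhs y)).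
  - exact: (@cvg_fst _ _ (nbhs x') (nbhs y')).
apply: hY => U V xU xV.
have [||z [Uz Vz]] := h (snd @^-1` U) (snd @^-1` V); last by exists z.2.
- exact: (@cvg_snd _ _ (nbhs x) (nbhs y)).
- exact: (@cvg_snd _ _ (nbhs x') (nbhs y')).
Qed.

Lemma compact_hausdorff_cgwh (X : topologicalType) :
  compact_hausdorff X -> cgwh X.
Proof.
move=> [cX hX]; split.
  by move=> A /(_ X id (conj cX hX)); apply => x.
move=> C h [cC _] ch; apply: compact_closed => //; apply: continuous_compact => //.
exact: continuous_subspaceT.
Qed.

Section Realization.
Context (R : realType).

Lemma sum_continuous (X : topologicalType) (I : finType) (D : pred I)
    (f : I -> X -> R) :
  (forall i, continuous (f i)) -> continuous (fun x => \sum_(i | D i) f i x).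
Proof.
move=> cf; apply: (@continuous_big R I +%R 0 D (@add_continuous R) X).
by move=> i _; exact: cf.
Qed.

Lemma weight_continuous d (P : finPOrderType d) p :
  continuous (fun x : realization R P => weight x p).
Proof.
move=> x; apply: (@continuous_comp _ _ _ set_val
  (fun y : prod_topology (fun _ : P => R) => y p)).
  exact: initial_continuous.
exact: (@proj_continuous _ (fun _ : P => R)).
Qed.

Lemma realization_continuous (X : topologicalType) d (P : finPOrderType d)
    (f : X -> realization R P) :
  (forall p, continuous (fun x => weight (f x) p)) -> continuous f.
Proof.
move=> cf; apply: set_type_continuous.
exact: (@prod_topology_continuous _ _ (fun _ : P => R^o)).
Qed.

Lemma realization_eq d (P : finPOrderType d) (x y : realization R P) :
  weight x =1 weight y -> x = y.
Proof. by move=> xy; apply: val_inj; apply/funext. Qed.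

Lemma realization_hausdorff d (P : finPOrderType d) :
  hausdorff_space (realization R P).
Proof.
apply: set_type_hausdorff; apply: hausdorff_product => _; exact: Rhausdorff.
Qed.

(** The realization is a closed subset of the compact cube of weights in [0, 1]. The chain condition
    is closed because it says that [x p * x q] vanishes for every incomparable pair. *)
Lemma realization_compact d (P : finPOrderType d) :
  compact [set: realization R P].
Proof.
apply: set_type_compact.
have pc p : continuous (fun x : prod_topology (fun _ : P => R) => x p : R).
  exact: (@proj_continuous _ (fun _ : P => R) p).
have cube : compact
    [set x : prod_topology (fun _ : P => R) | forall p, `[0, 1]%classic (x p)].
  apply: (@tychonoff P (fun _ => R) (fun _ => `[0, 1]%classic)) => p.
  exact: segment_compact.
apply: subclosed_compact cube _; last first.
  move=> x [x0 x1 _] p /=; rewrite in_itv /= x0 -x1 (bigD1 p) //= lerDl.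
  exact: sumr_ge0.
pose A1 := \bigcap_(p in [set: P])
  ((fun x : prod_topology (fun _ : P => R) => x p : R) @^-1` [set t | 0 <= t]).
pose A2 := (fun x : prod_topology (fun _ : P => R) => \sum_p x p : R)
  @^-1` [set 1].
pose A3 := \bigcap_(pq in [set pq : P * P | ~~ (pq.1 >=< pq.2)%O])
  ((fun x : prod_topology (fun _ : P => R) => x pq.1 * x pq.2 : R)
     @^-1` [set 0]).
have -> : realization_set (P := P) = A1 `&` A2 `&` A3.
  apply/seteqP; split=> [x [x0 x1 xc]|x [[x0 x1] xc]].
    split; first by split=> // p _; exact: x0.
    move=> [p q] /= pq; apply/eqP; rewrite mulf_eq0; apply: contraR pq.
    by rewrite negb_or => /andP[]; exact: xc.
  split=> [p||p q xp xq]; [exact: (x0 p)|exact: x1|].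
  apply: contraT => pq; have /= /eqP := xc (p, q) pq.
  by rewrite mulf_eq0 (negPf xp) (negPf xq).
apply: closedI; first apply: closedI.
- apply: closed_bigI => p _; apply: preimage_closed => [x _|]; first exact: pc.
  exact: closed_ge.
- apply: preimage_closed => [x _|]; last exact: closed_eq.
  by apply: sum_continuous => p; exact: pc.
- apply: closed_bigI => pq _; apply: preimage_closed => [x _|].
    exact: (@cvgM R _ (nbhs x) _ _ _ _ _ (pc _ x) (pc _ x)).
  exact: closed_eq.
Qed.

Lemma realize_map_continuous d d' (P : finPOrderType d) (Q : finPOrderType d')
    (phi : P -> Q) (phi_mono : {homo phi : p q / (p <= q)%O}) :
  continuous (realize_map (R := R) phi_mono).
Proof.
apply: realization_continuous => q; apply: sum_continuous => p.
exact: weight_continuous.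
Qed.

End Realization.

(** * Weights supported on chains *)

Section ChainWeight.
Context (R : realType) d (P : finPOrderType d).
Implicit Types x y : P -> R.

(** Two chain weights with equal functionals [L] are compared by repeatedly
    removing the same mass at an element common to both supports. *)
Lemma chain_weight_uniq (J : Type) (L : J -> P -> R) :
  (forall m m' x y, chain_weight m x -> chain_weight m' y ->
     (forall j, \sum_p x p * L j p = \sum_p y p * L j p) ->
     (exists p, x p != 0) -> exists p, x p != 0 /\ y p != 0) ->
  forall m m' x y, chain_weight m x -> chain_weight m' y ->
     (forall j, \sum_p x p * L j p = \sum_p y p * L j p) -> x =1 y.
Proof.
move=> common m m' x y; have [n] := ubnP (#|[pred p | x p != 0%R]| +
  #|[pred p | y p != 0%R]|)%N.
elim: n m m' x y => // n IHn m m' x y; rewrite ltnS => len hx hy xy.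
have [[p xp]|x0] := pselect (exists p, x p != 0); last first.
  have [[p yp]|y0] := pselect (exists p, y p != 0).
    have [|q [_ xq]] := common _ _ _ _ hy hx (fun j => esym (xy j)).
      by exists p.
    by case: x0; exists q.
  move=> p; transitivity (0 : R).
    by apply/eqP; apply: contra_notT x0; exists p.
  by apply/esym/eqP; apply: contra_notT y0; exists p.
have [{xp} {}p [xp yp]] := common _ _ _ _ hx hy xy (ex_intro _ p xp).
(* Subtracting the smaller of the two weights at [p] removes [p] from at least one support, so the
   total size of the supports decreases. *)
pose e := Num.min (x p) (y p).
have e_gt0 : 0 < e.
  case: hx => x0 _ _; case: hy => y0 _ _.
  by rewrite /e lt_min !lt_def xp yp x0 y0.
have ex : e <= x p by rewrite /e ge_min lexx.
have ey : e <= y p by rewrite /e ge_min lexx orbT.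
have [hx' sx] := chain_weight_peel hx e_gt0 ex.
have [hy' sy] := chain_weight_peel hy e_gt0 ey.
have sumE z j : \sum_q (z q - e * (q == p)%:R) * L j q =
    \sum_q z q * L j q - e * L j p.
  under eq_bigr do rewrite mulrBl.
  rewrite sumrB; congr (_ - _); rewrite (bigD1 p) //= eqxx mulr1 big1 ?addr0 //.
  by move=> q /negPf ->; rewrite mulr0 mul0r.
suff xy' : (fun q => x q - e * (q == p)%:R) =1 (fun q => y q - e * (q == p)%:R).
  by move=> q; have := xy' q; move/addIr.
apply: IHn hx' hy' _; last by move=> j; rewrite !sumE xy.
apply: leq_trans len; rewrite -ltnS.
have lex : (#|[pred q | (x q - e * (q == p)%:R)%R != 0%R]|
    <= #|[pred q | x q != 0%R]|)%N.
  by apply/subset_leq_card/fintype.subsetP => q; rewrite !inE; exact: sx.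
have ley : (#|[pred q | (y q - e * (q == p)%:R)%R != 0%R]|
    <= #|[pred q | y q != 0%R]|)%N.
  by apply/subset_leq_card/fintype.subsetP => q; rewrite !inE; exact: sy.
have [xy_p|yx_p] := leP (x p) (y p).
  rewrite -addSn ltnS leq_add //; apply/proper_card/properP; split.
    by apply/fintype.subsetP => q; rewrite !inE; exact: sx.
  exists p; rewrite !inE // eqxx mulr1 /e (min_idPl _) // subrr eqxx //.
rewrite -addnS ltnS leq_add //; apply/proper_card/properP; split.
  by apply/fintype.subsetP => q; rewrite !inE; exact: sy.
by exists p; rewrite !inE // eqxx mulr1 /e (min_idPr _) ?ltW // subrr eqxx.
Qed.

Lemma chain_weight_of_realization (x : realization R P) :
  chain_weight 1 (weight x).
Proof. by have [] := weightP x. Qed.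

Lemma chain_weight_greatest m x p1 : chain_weight m x -> x p1 != 0 ->
  exists p0, x p0 != 0 /\ forall p, x p != 0 -> (p <= p0)%O.
Proof.
move=> [_ _ xch] xp1.
pose above p := #|[pred q | (x q != 0) && (p <= q)%O]|.
have [p0 xp0 p0min] := @arg_minnP _ p1 [pred p | x p != 0] above xp1.
move: xp0 => /= xp0; exists p0; split=> // p xp; have := xch _ _ xp0 xp.
rewrite /Order.comparable => /orP[p0p|//].
have [->//|neq] := eqVneq p0 p.
have := p0min _ xp; rewrite leqNgt => /negP[]; apply: proper_card.
apply/properP; split.
  apply/fintype.subsetP => q; rewrite !inE => /andP[-> /=]; exact: le_trans.
exists p0; rewrite !inE ?xp0 ?lexx //=.
by apply/negP => H; move: neq; rewrite eq_le H p0p.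
Qed.

End ChainWeight.

Lemma realize_map_comp (R : realType) d1 d2 d3 (A : finPOrderType d1)
    (B : finPOrderType d2) (C : finPOrderType d3)
    (g : B -> C) (g_mono : {homo g : a b / (a <= b)%O})
    (h : A -> B) (h_mono : {homo h : a b / (a <= b)%O})
    (k : A -> C) (k_mono : {homo k : a b / (a <= b)%O}) (z : realization R A) :
  (forall a, g (h a) = k a) ->
  realize_map g_mono (realize_map h_mono z) = realize_map k_mono z.
Proof.
move=> ghk; apply: realization_eq => c; rewrite /weight /= /push_weight.
rewrite (exchange_big_dep (fun a => k a == c)) /=; last first.
  by move=> b a /eqP <- /eqP <-; rewrite ghk.
apply: eq_bigr => a /eqP kac; rewrite (big_pred1 (h a)) // => b /=.
by rewrite (eq_sym b); case: (h a =P b) => [<-|]; rewrite ?ghk ?kac ?eqxx ?andbF.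
Qed.

(** * Realization of a product of posets *)

Section RealizeProd.
Context (R : realType) d (P : finPOrderType d) (I : finType) d'
  (Q : I -> finPOrderType d').

Lemma push_weightE d1 d2 (A : finPOrderType d1) (B : finPOrderType d2)
    (phi : A -> B) (x : A -> R) b :
  push_weight phi x b = \sum_a x a * (phi a == b)%:R.
Proof.
rewrite /push_weight big_mkcond; apply: eq_bigr => a _.
by case: ifP; rewrite ?mulr1 ?mulr0.
Qed.

Lemma push_weight_neq0 d1 d2 (A : finPOrderType d1) (B : finPOrderType d2)
    (phi : A -> B) m (x : A -> R) b : chain_weight m x ->
  push_weight phi x b != 0 <-> exists2 a, x a != 0 & phi a = b.
Proof.
move=> [x0 _ _]; split=> [|[a xa <-]].
  apply: contraPP => H; apply/negP; rewrite negbK /push_weight big1 // => a.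
  by move=> /eqP ab; apply/eqP; apply: contra_notT H; exists a.
rewrite /push_weight (bigD1 a) //= gt_eqF // ltr_wpDr //.
  exact: sumr_ge0.
by rewrite lt_def xa x0.
Qed.

(** Every coordinate of the greatest element of one support occurs as a coordinate in the other
    support, because the marginals agree. The two greatest elements therefore bound each other
    componentwise and coincide, which gives [chain_weight_uniq] its common element. *)
Lemma realize_prod_inj : injective (@realize_prod d P I d' Q R).
Proof.
pose L (j : P + {i : I & Q i}) (a : prod_poset P Q) : R :=
  match j with
  | inl p => (prod_fst a == p)%:R
  | inr (existT i q) => (prod_comp i a == q)%:R
  end.
move=> z z' zz'; apply: realization_eq.
apply: (@chain_weight_uniq _ _ _ _ L _ 1 1 _ _
  (chain_weight_of_realization z) (chain_weight_of_realization z')); last first.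
  case=> [p|[i q]]; rewrite /= -!push_weightE.
    by have := congr1 (fun w => weight (fst w) p) zz'.
  by have := congr1 (fun w => weight (snd w i) q) zz'.
move=> m m' x y hx hy xy [a1 xa1].
have xy1 p : push_weight (@prod_fst _ P I _ Q) x p =
    push_weight (@prod_fst _ P I _ Q) y p.
  by rewrite !push_weightE; exact: xy (inl p).
have xy2 i q : push_weight (@prod_comp _ P I _ Q i) x q =
    push_weight (@prod_comp _ P I _ Q i) y q.
  by rewrite !push_weightE; exact: xy (inr (existT _ i q)).
have : push_weight (@prod_fst _ P I _ Q) x (prod_fst a1) != 0.
  by apply/(push_weight_neq0 _ _ hx); exists a1.
rewrite xy1 => /(push_weight_neq0 _ _ hy)[b1 yb1 _].
have [a [xa amax]] := chain_weight_greatest hx xa1.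
have [b [yb bmax]] := chain_weight_greatest hy yb1.
suff ab : a = b by exists a; rewrite xa ab yb.
have le1 (x' y' : prod_poset P Q -> R) m1 m2 c1 c2 :
    chain_weight m1 x' -> chain_weight m2 y' ->
    x' c1 != 0 -> (forall c, y' c != 0 -> (c <= c2)%O) ->
    (forall p, push_weight (@prod_fst _ P I _ Q) x' p =
      push_weight (@prod_fst _ P I _ Q) y' p) ->
    (forall i q, push_weight (@prod_comp _ P I _ Q i) x' q =
      push_weight (@prod_comp _ P I _ Q i) y' q) -> (c1 <= c2)%O.
  move=> hx' hy' xc ymax e1 e2; apply/andP; split.
    have : push_weight (@prod_fst _ P I _ Q) x' (prod_fst c1) != 0.
      by apply/(push_weight_neq0 _ _ hx'); exists c1.
    rewrite e1 => /(push_weight_neq0 _ _ hy')[c yc cE].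
    by rewrite -[c1.1]/(prod_fst c1) -cE; exact/prod_fst_mono/ymax.
  apply/forallP => i.
  have : push_weight (@prod_comp _ P I _ Q i) x' (prod_comp i c1) != 0.
    by apply/(push_weight_neq0 _ _ hx'); exists c1.
  rewrite e2 => /(push_weight_neq0 _ _ hy')[c yc cE].
  by rewrite -[c1.2 i]/(prod_comp i c1) -cE; exact/prod_comp_mono/ymax.
apply/le_anti/andP; split.
  exact: (le1 x y _ _ _ _ hx hy xa bmax xy1 xy2).
exact: (le1 y x _ _ _ _ hy hx yb amax (fun p => esym (xy1 p))
  (fun i q => esym (xy2 i q))).
Qed.

Lemma realize_prodK :
  cancel (@realize_prod d P I d' Q R) (@realize_prod_inv _ _ _ _ _ _).
Proof. by move=> z; apply: realize_prod_inj; rewrite realize_prod_invK. Qed.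

Lemma realize_prod_continuous : continuous (@realize_prod d P I d' Q R).
Proof.
move=> z; apply: (@cvg_pair _ _ _ (nbhs z) (nbhs _) (nbhs _)).
  exact: realize_map_continuous.
have H := @prod_topology_continuous _ _ (fun i => realization R (Q i)).
by apply: (H _ (fun z i => realize_map (@prod_comp_mono _ _ _ _ _ i) z)) => i;
  exact: realize_map_continuous.
Qed.

Lemma realize_prod_inv_continuous :
  continuous (@realize_prod_inv d P I d' Q R).
Proof.
apply: compact_hausdorff_homeomorphic realize_prod_continuous
  realize_prodK (@realize_prod_invK _ _ _ _ _ _).
  exact: realization_compact.
apply: pair_hausdorff; first exact: realization_hausdorff.
apply: hausdorff_product => i; exact: realization_hausdorff.
Qed.

Context d'' (W : finPOrderType d'').

Lemma realize_map2_continuous (phi : prod_poset P Q -> W)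
    (phi_mono : {homo phi : a b / (a <= b)%O}) :
  continuous (realize_map2 (R := R) phi_mono).
Proof.
move=> xy; apply: continuous_comp; first exact: realize_prod_inv_continuous.
exact: realize_map_continuous.
Qed.

(** This turns equations between realizations into equations between poset maps: once all arguments
    are images of one point [z], so is the value. The existential keeps the monotonicity proof out
    of the way. *)
Lemma realize_map2_realize_map d0 (A : finPOrderType d0)
    (phi : prod_poset P Q -> W) (phi_mono : {homo phi : a b / (a <= b)%O})
    (al : A -> P) (al_mono : {homo al : a b / (a <= b)%O})
    (be : forall i, A -> Q i) (be_mono : forall i, {homo be i : a b / (a <= b)%O})
    (z : realization R A) x y :
  x = realize_map al_mono z -> (forall i, y i = realize_map (be_mono i) z) ->
  exists psi_mono : {homo (fun a => phi (al a, [ffun i => be i a])) :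
    a b / (a <= b)%O},
  realize_map2 phi_mono (x, y) = realize_map psi_mono z.
Proof.
move=> -> yE; have {yE} -> : y = fun i => realize_map (be_mono i) z.
  exact: functional_extensionality_dep.
pose ab a : prod_poset P Q := (al a, [ffun i => be i a]).
have ab_mono : {homo ab : a b / (a <= b)%O}.
  move=> a b le_ab; apply/andP; split; first exact: al_mono.
  by apply/forallP => i; rewrite /= !ffunE; exact: be_mono.
exists (fun a b le_ab => phi_mono _ _ (ab_mono a b le_ab)).
have -> : (realize_map al_mono z, fun i => realize_map (be_mono i) z) =
    realize_prod (realize_map ab_mono z).
  congr pair; first by apply/esym/realize_map_comp.
  apply: functional_extensionality_dep => i; apply/esym/realize_map_comp => a.
  by rewrite /prod_comp /= ffunE.
by rewrite /realize_map2 realize_prodK; exact: realize_map_comp.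
Qed.

End RealizeProd.

(** * Tubings of a graph *)

Section Tubings.
Context (T : finType) (adj : rel T).

(** Connectedness of the subgraph induced on [A]: no subset [B] cuts [A] without
    cutting an edge. *)
Definition cut_connected (A : {set T}) : Prop :=
  forall B : {set T}, (exists2 j, j \in A & j \in B) ->
    (exists2 k, k \in A & k \notin B) ->
    exists j k, [/\ j \in A, j \in B, k \in A, k \notin B & adj j k].

Definition boundary (A : {set T}) : {pred T} :=
  fun k => (k \notin A) && [exists j in A, adj j k].

Definition tube (A : {set T}) : Prop :=
  [/\ A != finset.set0, A != finset.setT & cut_connected A].

Definition tubes_compatible (I J : {set T}) : Prop :=
  [\/ I \subset J, J \subset I |
      forall i j, i \in I -> j \in J -> i != j /\ ~~ adj i j].

Definition tubing (p : {set {set T}}) : Prop :=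
  (forall I, I \in p -> tube I) /\
  (forall I J, I \in p -> J \in p -> tubes_compatible I J).

Hypothesis adj_sym : symmetric adj.

Lemma boundaryP (A : {set T}) k :
  reflect (k \notin A /\ exists2 j, j \in A & adj j k) (k \in boundary A).
Proof.
apply: (iffP andP) => -[kA H]; split=> //.
  by case/existsP: H => j /andP[jA jk]; exists j.
by case: H => j jA jk; apply/existsP; exists j; rewrite jA.
Qed.

(** Incompatibility gives an element of [I] equal or adjacent to some [j] in [J]. If [j] lies
    outside [I] it is the vertex sought; otherwise [J] meets [I] without being contained in it, and
    connectedness of [J] yields an edge of [J] leaving [I]. *)
Lemma incompatible_boundary I J : cut_connected J -> ~ tubes_compatible I J ->
  exists2 k, k \in J & k \in boundary I.
Proof.
move=> cJ IJ.
have [[i [j [iI jJ ij]]]|H] :=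
    pselect (exists i j, [/\ i \in I, j \in J & (i == j) || adj i j]); last first.
  case: IJ; apply: Or33 => i j iI jJ; apply/andP; rewrite -negb_or.
  by apply: contra_notN H => ij; exists i, j.
have [jI|jI] := boolP (j \in I); last first.
  exists j => //; apply/boundaryP; split=> //; exists i => //.
  by case/orP: ij => // /eqP ij; rewrite -ij iI in jI.
have [//||k] := cJ I; first by exists j.
  have /subsetPn[k kJ kI] : ~~ (J \subset I).
    by apply/negP => JI; apply: IJ; exact: Or32.
  by exists k.
move=> [l [kJ kI lJ lI kl]]; exists l => //; apply/boundaryP; split=> //.
by exists k.
Qed.

Lemma tubes_compatibleC I J : tubes_compatible I J -> tubes_compatible J I.
Proof.
case=> [IJ|JI|H]; [exact: Or32|exact: Or31|apply: Or33 => j i jJ iI].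
by rewrite eq_sym adj_sym; exact: H.
Qed.

Lemma adjacent_tube_sub I J i j : tubes_compatible I J -> i \in I -> j \in J ->
  (i == j) || adj i j -> j \notin I -> I \subset J.
Proof.
move=> IJ iI jJ ij jI; case: IJ => [//|/fintype.subsetP JI|H].
  by move: (JI _ jJ); rewrite (negPf jI).
by have [/negPf ne /negPf na] := H _ _ iI jJ; rewrite ne na in ij.
Qed.

(** A tube missing from [p] is not a component of a superlevel set of the depth
    function of any subset of [p]. *)
Lemma tubing_separation (p : {set {set T}}) J : cut_connected finset.setT ->
  tubing p -> tube J -> J \notin p ->
  exists j k, [/\ j \in J, k \in boundary J &
    forall K, K \in p -> j \in K -> k \in K].
Proof.
move=> cT [ptube pcomp] [J0 JT cJ] Jp.
have inM : finset.setT \in [pred K : {set T} |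
    ((K \in p) || (K == finset.setT)) && (J \subset K)].
  by rewrite inE eqxx orbT finset.subsetT.
(* [M] has least cardinality among the members of [p], together with the whole vertex set, that
   contain [J]. As [J] is none of these, [M] is strictly larger, and its connectedness gives a [k]
   in [M] adjacent to [J]. *)
have [M /andP[Mp JM] Mmin] := @arg_minnP _ finset.setT _ (fun K => #|K|) inM.
have cM : cut_connected M.
  by case/orP: Mp => [/ptube[]//|/eqP ->].
have [j0 j0J] := finset.set0Pn _ J0.
have [||j1 [k [j1M j1J kM kJ j1k]]] := cM J.
- by exists j0 => //; exact: (fintype.subsetP JM).
- apply/subsetPn; apply: contraNN Jp => MJ.
  have MJE : J = M by apply/eqP; rewrite finset.eqEsubset JM.
  by case/orP: Mp => [|/eqP ME]; rewrite MJE // -ME -MJE eqxx in JT *.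
have kb : k \in boundary J by apply/boundaryP; split=> //; exists j1.
(* Otherwise this fixed [k] is cut off from every [j] in [J] by some member of [p]. *)
apply: contrapT => none.
have sep j : j \in J -> exists K, [/\ K \in p, j \in K & k \notin K].
  move=> jJ; apply: contrapT => noK; apply: none; exists j, k; split=> // K Kp jK.
  by apply: contraT => kK; case: noK; exists K.
have [K0 [K0p j0K0 kK0]] := sep _ j0J.
have inI : K0 \in [pred K : {set T} | [&& K \in p, ~~ [disjoint K & J] &
    k \notin K]].
  rewrite inE K0p kK0 andbT /=; apply/pred0Pn; exists j0 => /=.
  by rewrite j0K0 j0J.
(* [I] has largest cardinality among the members of [p] that meet [J] and miss [k]. An edge of [J]
   leaving [I] would end in a member of [p] missing [k] and strictly containing [I], so [J] lies in
   [I]. Compatibility of [I] with [M] is then impossible, [M] being minimal and containing [k]. *)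
have [I /and3P[Ip IJ kI] Imax] := @arg_maxnP _ K0 _ (fun K => #|K|) inI.
have /pred0Pn[i /= /andP[iI iJ]] := IJ.
have JI : J \subset I.
  apply: contraT => /subsetPn[j' j'J j'I].
  have [||a [b [aJ aI bJ bI ab]]] := cJ I; [by exists i|by exists j'|].
  have [K [Kp bK kK]] := sep _ bJ.
  have IK : I \subset K.
    by apply: (adjacent_tube_sub (pcomp _ _ Ip Kp) aI bK) => //; rewrite ab orbT.
  have KI : (#|K| <= #|I|)%N.
    apply: Imax; apply/and3P; split=> //.
    by apply/pred0Pn; exists b => /=; rewrite bK bJ.
  move: KI; rewrite leqNgt => /negP[]; apply: proper_card; apply/properP; split=> //.
  by exists b.
have MI : (#|M| <= #|I|)%N by apply: Mmin; rewrite /= Ip JI.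
case/orP: Mp => [Mp|/eqP ME]; last first.
  have IT : I = finset.setT.
    by apply/eqP; rewrite finset.eqEcard finset.subsetT -ME MI.
  by rewrite IT finset.inE in kI.
case: (pcomp _ _ Mp Ip) => [/fintype.subsetP/(_ _ kM)|IM|H].
- by rewrite (negPf kI).
- have IE : I = M by apply/eqP; rewrite finset.eqEcard IM.
  by rewrite IE kM in kI.
- have [] := H j0 j0; rewrite ?eqxx //; first exact: (fintype.subsetP JM).
  exact: (fintype.subsetP JI).
Qed.

Lemma tube_boundary I : cut_connected finset.setT -> tube I ->
  exists k, k \in boundary I.
Proof.
move=> cT [I0 IT _]; have [i iI] := finset.set0Pn _ I0.
have [||j [k [_ jI _ kI jk]]] := cT I.
- by exists i.
- have : ~~ (finset.setT \subset I) by rewrite finset.subTset.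
  by move=> /subsetPn[k kT kI]; exists k.
by exists k; apply/boundaryP; split=> //; exists j.
Qed.

(** * Components of the superlevel sets of a function *)

Section Level.
Context (R : realType) (h : T -> R).

(** [I] is a connected component of some superlevel set [{h >= s}], other than
    the whole of [T]. *)
Definition level_tube (I : {set T}) : Prop :=
  tube I /\ forall j k, j \in I -> k \in boundary I -> h k < h j.

(** If [I] and [J] were incompatible, each would contain a boundary vertex of the other, and each of
    these two vertices would be strictly higher than the other. *)
Lemma level_tube_compatible I J : level_tube I -> level_tube J ->
  tubes_compatible I J.
Proof.
move=> [[_ _ cI] hI] [[_ _ cJ] hJ]; apply: contrapT => IJ.
have [k kJ kI] := incompatible_boundary cJ IJ.
have [|k' k'I k'J] := @incompatible_boundary J I cI.
  by move=> /tubes_compatibleC.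
by have := lt_trans (hI _ _ k'I kI) (hJ _ _ kJ k'J); rewrite ltxx.
Qed.

(** The tube is the component of [g] in the superlevel set at height [h g]; the lower vertex [g0]
    guarantees that it is not everything. *)
Lemma level_component g g0 : h g0 < h g ->
  exists I, [/\ level_tube I, g \in I & forall j, j \in I -> h g <= h j].
Proof.
move=> g0g; pose e := [rel x y | [&& adj x y, h g <= h x & h g <= h y]].
have e_sym : connect_sym e.
  by apply: sym_connect_sym => x y /=; rewrite adj_sym [X in _ && X]andbC.
pose C := finset (fun k => connect e g k).
have CE k : (k \in C) = connect e g k by rewrite finset.inE.
have hC k : k \in C -> h g <= h k.
  rewrite CE; have cl : fingraph.closed e [pred x | h g <= h x].
    by move=> x y /and3P[_ hx hy]; rewrite !inE hx hy.
  by move=> /(closed_connect cl); rewrite !inE lexx => <-.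
have Cext x y : x \in C -> adj x y -> h g <= h y -> y \in C.
  move=> xC xy hy; rewrite CE; apply: (connect_trans (y := x)).
    by rewrite -CE.
  by apply: connect1; rewrite /= xy hy hC.
have gC : g \in C by rewrite CE connect0.
exists C; split=> //; split.
  split.
  - by apply/finset.set0Pn; exists g.
  - apply: contraTneq g0g => CT; rewrite -leNgt; apply: hC.
    by rewrite CT finset.inE.
  - move=> B [j jC jB] [k kC kB]; apply: contrapT => none.
    (* A cut crossed by no edge would be closed under [e], although all of [C] is linked to [g]. *)
    have cl : fingraph.closed e [pred x | (x \in C) && (x \in B)].
      apply: (intro_closed e_sym) => x y /and3P[xy hx hy] /andP[xC xB].
      rewrite inE (Cext _ _ xC xy hy) /=; apply: contraT => yB.
      by case: none; exists x, y; split=> //; exact: Cext xC xy hy.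
    have jk : connect e j k.
      by apply: (connect_trans (y := g)); rewrite -?CE // e_sym -CE.
    have : (j \in C) && (j \in B) = (k \in C) && (k \in B).
      exact: (closed_connect cl jk).
    by rewrite jC jB kC (negPf kB).
move=> j k jC /boundaryP[kC [j' j'C j'k]]; apply: (@lt_le_trans _ _ (h g)).
  by rewrite ltNge; apply: contra kC; exact: Cext j'C j'k.
exact: hC.
Qed.

(** [lam I] is the drop from the lowest value of [h] on [I] to its highest value on the boundary of
    [I]. The level tubes containing a given vertex are nested, and their drops telescope to its
    height above the minimum of [h]. *)
Lemma level_decomposition : cut_connected finset.setT ->
  exists lam : {set T} -> R, [/\ forall I, 0 <= lam I,
    forall I, lam I != 0 -> level_tube I &
    forall j k, h j - h k =
      \sum_(I : {set T} | j \in I) lam I - \sum_(I : {set T} | k \in I) lam I].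
Proof.
move=> cT.
have ex_lam0 (I : {set T}) : exists l : R, tube I -> exists a e,
    [/\ a \in I, e \in boundary I, forall j, j \in I -> h a <= h j,
        forall k, k \in boundary I -> h k <= h e & l = h a - h e].
  have [tI|ntI] := pselect (tube I); last by exists 0.
  have [I0 _ _] := tI; have [a0 a0I] := finset.set0Pn _ I0.
  have [e0 e0I] := tube_boundary cT tI.
  have [a aI amin] := @arg_minP _ _ _ a0 (mem I) h a0I.
  have [e eI emax] := @arg_maxP _ _ _ e0 (mem (boundary I)) h e0I.
  by exists (h a - h e) => _; exists a, e; split.
have [lam0 lam0P] := boolp.choice ex_lam0.
pose lam I := if `[< level_tube I >] then lam0 I else 0.
have lamE I : level_tube I -> exists a e,
    [/\ a \in I, e \in boundary I, forall j, j \in I -> h a <= h j,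
        forall k, k \in boundary I -> h k <= h e & lam I = h a - h e].
  by move=> lI; rewrite /lam asboolT //; exact/lam0P/lI.1.
(* Induction on the number of strictly lower vertices, passing from [g] to the highest boundary
   vertex [e] of its component. *)
have key g0 : (forall j, h g0 <= h j) -> forall g,
    \sum_(I : {set T} | g \in I) lam I = h g - h g0.
  move=> g0min g; have [n] := ubnP #|[pred k | h k < h g]|.
  elim: n g => // n IHn g; rewrite ltnS => len.
  have := g0min g; rewrite le_eqVlt => /orP[/eqP g0g|g0g].
    rewrite g0g subrr big1 // => I gI; rewrite /lam; case: asboolP => // lI.
    have [e eI] := tube_boundary cT lI.1.
    by have := lI.2 _ _ gI eI; rewrite -g0g ltNge g0min.
  have [I [lI gI hI]] := level_component g0g.
  have [a [e [aI eI amin emax lamI]]] := lamE _ lI.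
  have ha : h a = h g by apply/le_anti; rewrite amin ?hI.
  have eg : h e < h g by exact: lI.2.
  have /boundaryP[eNI [i iI ie]] := eI.
  rewrite (bigD1 I) //= lamI ha.
  (* The level tubes containing [g] are [I] and those containing [e], a highest
     vertex of the boundary of [I]. *)
  have -> : h g - h g0 = (h g - h e) + (h e - h g0) by rewrite addrA subrK.
  congr (_ + _); rewrite -IHn; last first.
    apply: leq_trans len; apply: proper_card; apply/properP; split.
      by apply/fintype.subsetP => k; rewrite !inE => /lt_trans; exact.
    by exists e; rewrite !inE ?ltxx.
  rewrite big_mkcond [RHS]big_mkcond; apply: eq_bigr => J _.
  have [->|JI] /= := eqVneq J I; first by rewrite andbF (negPf eNI).
  rewrite andbT /lam; case: asboolP => [lJ|_]; last by rewrite !if_same.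
  suff -> : (g \in J) = (e \in J) by [].
  have IJ := level_tube_compatible lI lJ.
  apply/idP/idP => [gJ|eJ]; last first.
    suff /fintype.subsetP : I \subset J by exact.
    by apply: (adjacent_tube_sub IJ iI eJ) => //; rewrite ie orbT.
  (* If [J] contains [g] and lies properly inside [I], an edge leaves [J] for a vertex of [I]
     strictly lower than [g], contrary to the choice of [I]. *)
  have [JsI|JsI] := boolP (J \subset I).
    have /subsetPn[i' i'I i'J] : ~~ (I \subset J).
      by apply: contra JI => IsJ; rewrite finset.eqEsubset JsI.
    have [||b [c [bI bJ cI cJ bc]]] := (let: And3 _ _ x := lI.1 in x) J.
    - by exists g.
    - by exists i'.
    have cb : c \in boundary J by apply/boundaryP; split=> //; exists b.
    by have := lJ.2 _ _ gJ cb; rewrite ltNge hI.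
  have /subsetPn[j jJ jI] := JsI.
  (* Here [I] lies properly inside [J]. If [e] were outside [J] it would be a boundary vertex of
     [J], hence strictly lower than the vertex [c] where an edge of [J] leaves [I]; but [e] is
     highest on the boundary of [I]. *)
  have IsJ : I \subset J.
    case: IJ => [//|JsI'|H]; first by rewrite JsI' in JsI.
    by have [] := H _ _ gI gJ; rewrite eqxx.
  have [||b [c [bJ bI cJ cI bc]]] := (let: And3 _ _ x := lJ.1 in x) I.
  - by exists g.
  - by exists j.
  have cb : c \in boundary I by apply/boundaryP; split=> //; exists b.
  apply: contraT => eJ; have eb : e \in boundary J.
    by apply/boundaryP; split=> //; exists i => //; exact: (fintype.subsetP IsJ).
  by have := lJ.2 _ _ cJ eb; rewrite ltNge emax.
exists lam; split.
- move=> I; rewrite /lam; case: asboolP => // lI.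
  have [a [e [aI eI _ _]]] := lamE _ lI; rewrite /lam asboolT // => ->.
  by rewrite subr_ge0 ltW // lI.2.
- by move=> I; rewrite /lam; case: asboolP => //; rewrite eqxx.
- move=> j k; have [g0 _ g0min] := @arg_minP _ _ _ j xpredT h isT.
  have g0min' i : h g0 <= h i by exact: g0min.
  by rewrite !(key _ g0min') opprB addrA subrK.
Qed.

End Level.

(** * Depth functions of weighted chains of tubings *)

Section Depth.
Context (R : realType) d (P : finPOrderType d) (tub : P -> {set {set T}}).
Hypothesis tub_le : forall p q, (p <= q)%O = (tub q \subset tub p).
Hypothesis tub_tubing : forall p, tubing (tub p).
Hypothesis tub_surj : forall s, tubing s -> exists p, tub p = s.
Hypothesis connT : cut_connected finset.setT.

Definition depth (p : P) (g : T) : R := \sum_(I in tub p) (g \in I)%:R.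

Definition depth_sum (x : P -> R) (g : T) : R := \sum_p x p * depth p g.

Lemma tub_inj : injective tub.
Proof. by move=> p q pq; apply/le_anti; rewrite !tub_le pq fintype.subxx. Qed.

(** The least element [p0] of the support carries all tubes that occur. For [I] in [tub p0], every
    occurring tube containing a boundary vertex of [I] contains [I], and [I] itself makes the
    inequality strict. For a tube [I] outside, [tubing_separation] supplies a boundary vertex at
    least as deep as some vertex of [I]. *)
Lemma level_tube_depth_sum m (x : P -> R) p0 I : chain_weight m x ->
  x p0 != 0 -> (forall p, x p != 0 -> (p0 <= p)%O) ->
  level_tube (depth_sum x) I <-> I \in tub p0.
Proof.
move=> [x0 _ _] xp0 p0min; have [tub1 tub2] := tub_tubing p0.
have sub p : x p != 0 -> {subset tub p <= tub p0}.
  by move=> /p0min; rewrite tub_le => /fintype.subsetP.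
split=> [[tI hI]|Ip0].
  apply: contraT => /(tubing_separation connT (tub_tubing p0) tI).
  move=> [j [k [jI kI jk]]]; have := hI _ _ jI kI; rewrite ltNge => /negP[].
  apply: ler_sum => p _; have [->|xp] := eqVneq (x p) 0; first by rewrite !mul0r.
  apply: ler_wpM2l => //; apply: ler_sum => K Kp; rewrite ler_nat.
  by case: (boolP (j \in K)) => // /(jk _ (sub _ xp _ Kp)) ->.
split=> [|j k jI /boundaryP[kI [i iI ik]]]; first exact: tub1.
have jk p K : x p != 0 -> K \in tub p -> k \in K -> j \in K.
  move=> xp Kp kK; suff /fintype.subsetP : I \subset K by exact.
  apply: (adjacent_tube_sub (tub2 _ _ Ip0 (sub _ xp _ Kp)) iI kK) => //.
  by rewrite ik orbT.
have dle p : x p != 0 -> depth p k <= depth p j.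
  move=> xp; apply: ler_sum => K Kp; rewrite ler_nat.
  by case: (boolP (k \in K)) => // /(jk _ _ xp Kp) ->.
have xp0_gt0 : 0 < x p0 by rewrite lt_def xp0 x0.
rewrite /depth_sum (bigD1 p0) //= [ltRHS](bigD1 p0) //=; apply: ltr_leD.
  rewrite ltr_pM2l // /depth (bigD1 I) //= [ltRHS](bigD1 I) //=.
  rewrite jI (negPf kI) add0r; apply: (@le_lt_trans _ _
    (\sum_(K in tub p0 | K != I) (j \in K)%:R)); last by rewrite ltrDr ltr01.
  apply: ler_sum => K /andP[Kp _]; rewrite ler_nat.
  by case: (boolP (k \in K)) => // /(jk _ _ xp0 Kp) ->.
apply: ler_sum => p _; have [->|xp] := eqVneq (x p) 0; first by rewrite !mul0r.
by apply: ler_wpM2l => //; exact: dle.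
Qed.

(** Depth does not see the weight at the empty tubing [pe], so that weight is matched separately.
    When it vanishes, the least elements of both supports are recovered from the level tubes of the
    same function modulo constants, hence coincide, and [chain_weight_uniq] applies. *)
Lemma depth_sum_inj m m' (x y : P -> R) pe : tub pe = finset.set0 ->
  chain_weight m x -> chain_weight m' y -> x pe = y pe ->
  (forall j k, depth_sum x j - depth_sum x k = depth_sum y j - depth_sum y k) ->
  x =1 y.
Proof.
move=> tpe hx hy xype xy.
pose L (i : option (T * T)) p :=
  if i is Some (j, k) then depth p j - depth p k else (p == pe)%:R.
have L1 z : \sum_p z p * L None p = z pe.
  rewrite (bigD1 pe) //= eqxx mulr1 big1 ?addr0 // => p /negPf ->.
  by rewrite mulr0.
have L2 z j k : \sum_p z p * L (Some (j, k)) p = depth_sum z j - depth_sum z k.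
  by rewrite /depth_sum -sumrB; apply: eq_bigr => p _; rewrite /= mulrBr.
apply: (@chain_weight_uniq _ _ _ _ L _ m m' _ _ hx hy); last first.
  by case=> [[j k]|]; rewrite ?L1 // !L2.
move=> {m m' x y hx hy xype xy} m m' x y hx hy xy [p1 xp1].
have [xpe|xpe] := eqVneq (x pe) 0; last first.
  by exists pe; split=> //; rewrite -L1 -xy L1.
have ype : y pe = 0 by rewrite -L1 -xy L1.
have hN I : level_tube (depth_sum x) I <-> level_tube (depth_sum y) I.
  suff H z z' : (forall j k, depth_sum z j - depth_sum z k =
      depth_sum z' j - depth_sum z' k) ->
      level_tube (depth_sum z) I -> level_tube (depth_sum z') I.
    by split; apply: H => j k; rewrite -!L2 ?xy.
  move=> zz' [tI hI]; split=> // j k jI kI.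
  by rewrite -subr_gt0 -zz' subr_gt0; exact: hI.
have greatest_least m1 (z : P -> R) : chain_weight m1 z -> z pe = 0 ->
    forall p2, z p2 != 0 -> exists p, [/\ z p != 0, p != pe &
      forall q, z q != 0 -> (p <= q)%O].
  move=> hz zpe p2 zp2; have [|p [zp pmin]] := chain_weight_least hz.
    case: (hz) => z0 <- _; rewrite (bigD1 p2) //=; apply: ltr_wpDr.
      exact: sumr_ge0.
    by rewrite lt_def zp2 z0.
  by exists p; split=> //; apply: contraNneq zp => ->; rewrite zpe.
have [p [xp ppe pmin]] := greatest_least _ _ hx xpe _ xp1.
have [I Ip] : exists I, I \in tub p.
  apply/finset.set0Pn; apply: contra ppe => /eqP tp.
  by apply/eqP/tub_inj; rewrite tp tpe.
have lI : level_tube (depth_sum y) I.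
  by apply/hN; apply/(level_tube_depth_sum _ hx xp pmin).
(* A level tube forces [depth_sum y] to be nonconstant, so the support of [y] is nonempty. *)
have [q1 yq1] : exists q, y q != 0.
  apply: contrapT => y0; have [e eI] := tube_boundary connT lI.1.
  have /boundaryP[_ [j jI _]] := eI; have := lI.2 _ _ jI eI.
  have sum0 g : depth_sum y g = 0.
    rewrite /depth_sum big1 // => q _; suff -> : y q = 0 by rewrite mul0r.
    by apply/eqP; apply: contra_notT y0; exists q.
  by rewrite !sum0 ltxx.
have [q [yq qpe qmin]] := greatest_least _ _ hy ype _ yq1.
exists p; split=> //; suff -> : p = q by [].
apply/tub_inj/setP => J; apply/idP/idP => H.
  by apply/(level_tube_depth_sum _ hy yq qmin)/hN/(level_tube_depth_sum _ hx xp pmin).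
by apply/(level_tube_depth_sum _ hx xp pmin)/hN/(level_tube_depth_sum _ hy yq qmin).
Qed.

Lemma tubing_sub (s s' : {set {set T}}) : tubing s -> s' \subset s -> tubing s'.
Proof.
move=> [s1 s2] /fintype.subsetP ss'; split=> [I /ss'|I J /ss' Is /ss'].
  exact: s1.
exact: s2.
Qed.

(** Put the least nonzero value [m] of [lam] as mass on the tubing formed by the whole support of
    [lam], and subtract [m] from [lam] on that support. The support shrinks at each stage, so the
    tubings produced form a chain. *)
Lemma chain_decomposition (lam : {set T} -> R) pe : tub pe = finset.set0 ->
  (forall I, 0 <= lam I) -> tubing (finset (fun I => lam I != 0)) ->
  exists x : P -> R, [/\ chain_weight (\sum_p x p) x, x pe = 0,
    forall p, x p != 0 -> tub p \subset finset (fun I => lam I != 0) &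
    forall I, \sum_(p | I \in tub p) x p = lam I].
Proof.
move=> tpe; have [n] := ubnP #|finset (fun I => lam I != 0)|.
elim: n lam => // n IHn lam; rewrite ltnS => len lam_ge0 tlam.
have [supp0|/finset.set0Pn[I0]] := eqVneq (finset (fun I => lam I != 0)) finset.set0.
  have lam0 I : lam I = 0.
    by move/setP: supp0 => /(_ I); rewrite !finset.inE => /negbFE/eqP.
  exists (fun=> 0); split=> //.
  - by split=> // p q; rewrite eqxx.
  - by move=> p; rewrite eqxx.
  - by move=> I; rewrite lam0 big1.
rewrite finset.inE => I0supp; have [p tp] := tub_surj tlam.
have [I1 I1supp I1min] := @arg_minP _ _ _ I0 [pred I | lam I != 0] lam I0supp.
rewrite /= in I1supp I1min.
pose m := lam I1; have m_gt0 : 0 < m by rewrite lt_def I1supp lam_ge0.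
pose lam' I := lam I - m * (lam I != 0)%:R.
have lam'0 I : lam I = 0 -> lam' I = 0.
  by move=> lI; rewrite /lam' lI eqxx mulr0 subrr.
have sub : finset (fun I => lam' I != 0) \subset finset (fun I => lam I != 0).
  by apply/fintype.subsetP => I; rewrite !finset.inE; apply: contra_neq; exact: lam'0.
have [|||x [[x0 _ xch] xpe xsub xlam]] := IHn lam'.
- apply: leq_trans len; apply: proper_card; apply/properP; split=> //.
  exists I1; rewrite !finset.inE ?I1supp //.
  by rewrite /lam' I1supp mulr1 subrr eqxx.
- move=> I; rewrite /lam'; case: (boolP (lam I != 0)) => [H|].
    by rewrite mulr1 subr_ge0; exact: I1min.
  by rewrite negbK mulr0 subr0.
- exact: tubing_sub tlam sub.
have xle q : x q != 0 -> (p <= q)%O.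
  by move=> /xsub H; rewrite tub_le tp; exact: fintype.subset_trans H sub.
exists (fun q => x q + m * (q == p)%:R); split.
- split=> // [q|q q']; first by rewrite addr_ge0 // mulr_ge0 // ltW.
  have [->|qp] := eqVneq q p; have [->|q'p] := eqVneq q' p;
    rewrite ?comparablexx // ?mulr0 ?addr0.
  + by move=> _ /xle; rewrite /Order.comparable => ->.
  + by move=> /xle; rewrite /Order.comparable => ->; rewrite orbT.
  + exact: xch.
- rewrite xpe add0r; have [pep|] := eqVneq pe p; last by rewrite mulr0.
  by move/setP: tp => /(_ I0); rewrite -pep tpe !finset.inE I0supp.
- move=> q; have [->|qp] := eqVneq q p; first by rewrite tp.
  by rewrite mulr0 addr0 => /xsub H; exact: fintype.subset_trans H sub.
- move=> I; rewrite big_split /= xlam /lam' -[RHS](subrK (m * (lam I != 0)%:R)).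
  congr (_ + _); rewrite -mulr_sumr; congr (_ * _).
  have -> : (lam I != 0) = (I \in tub p) by rewrite tp finset.inE.
  have [Ip|Ip] := boolP (I \in tub p).
    by rewrite (bigD1 p) //= eqxx big1 ?addr0 // => q /andP[_ /negPf ->].
  rewrite big1 // => q Iq; case: eqP => // qp.
  by rewrite -qp Iq in Ip.
Qed.

(** The level tubes of [h] are regrouped along a chain of tubings by exchanging the order of
    summation. The total mass stays free: this parametrizes a cone, to be rescaled later. *)
Lemma depth_sum_surj (h : T -> R) pe : tub pe = finset.set0 ->
  exists x : P -> R, [/\ chain_weight (\sum_p x p) x, x pe = 0 &
    forall j k, depth_sum x j - depth_sum x k = h j - h k].
Proof.
move=> tpe; have [lam [lam0 lamN lamE]] := level_decomposition h connT.
have [|x [hx xpe _ xlam]] := chain_decomposition tpe lam0.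
  split=> [I|I J]; rewrite !finset.inE; first by case/lamN.
  by move=> /lamN lI /lamN lJ; exact: level_tube_compatible lI lJ.
exists x; split=> // j k; rewrite lamE.
suff sumE g : depth_sum x g = \sum_(I : {set T} | g \in I) lam I by rewrite !sumE.
rewrite /depth_sum; under eq_bigr do rewrite /depth mulr_sumr.
rewrite (exchange_big_dep predT) //= [RHS]big_mkcond; apply: eq_bigr => I _.
rewrite -mulr_suml xlam; case: ifP; by rewrite ?mulr1 ?mulr0.
Qed.

End Depth.
End Tubings.

(** * The homeomorphism with the disc *)

Section TubingDisc.
Context (R : realType).

Lemma row_continuous (X : topologicalType) m (f : X -> 'rV[R]_m) :
  (forall i, continuous (fun x => f x ord0 i)) -> continuous f.
Proof.
move=> cf x U [B nB BU]; apply: (@filterS _ (nbhs x) _ _ _ (fun y => @BU (f y))).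
rewrite /=; apply: filter_forall => i; apply: filter_forall => j.
rewrite (ord1 i); apply: cf.
by move: (nB ord0 j).
Qed.

(** The Euclidean norm, by which the disc is defined, whereas the topology of row vectors is that of
    the entries. *)
Definition row_norm m (v : 'rV[R]_m) : R := Num.sqrt (\sum_i v ord0 i ^+ 2).

Lemma row_norm_sqr m (v : 'rV[R]_m) : row_norm v ^+ 2 = \sum_i v ord0 i ^+ 2.
Proof. by rewrite sqr_sqrtr // sumr_ge0 // => i _; rewrite sqr_ge0. Qed.

Lemma row_norm_ge0 m (v : 'rV[R]_m) : 0 <= row_norm v.
Proof. exact: sqrtr_ge0. Qed.

Lemma row_norm_coord m (v : 'rV[R]_m) i : `|v ord0 i| <= row_norm v.
Proof.
rewrite -(@ler_pXn2r _ 2) ?nnegrE ?row_norm_ge0 // row_norm_sqr.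
rewrite real_normK ?num_real //.
by rewrite (bigD1 i) //= lerDl sumr_ge0 // => j _; rewrite sqr_ge0.
Qed.

Lemma row_norm_eq0 m (v : 'rV[R]_m) : row_norm v = 0 -> v = 0.
Proof.
move=> v0; apply/rowP => i; rewrite mxE; apply/eqP.
by rewrite -normr_le0 -v0 row_norm_coord.
Qed.

Lemma row_normZ m r (v : 'rV[R]_m) : 0 <= r -> row_norm (r *: v) = r * row_norm v.
Proof.
move=> r0; rewrite /row_norm; under eq_bigr do rewrite mxE exprMn.
by rewrite -mulr_sumr sqrtrM ?sqr_ge0 // sqrtr_sqr ger0_norm.
Qed.

Lemma row_norm0 m : row_norm (0 : 'rV[R]_m) = 0.
Proof. by rewrite -(scale0r (0 : 'rV[R]_m)) row_normZ // mul0r. Qed.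

Lemma row_norm_continuous (X : topologicalType) m (f : X -> 'rV[R]_m) :
  (forall i, continuous (fun x => f x ord0 i)) ->
  continuous (fun x => row_norm (f x)).
Proof.
move=> cf x; apply: (@continuous_comp _ _ _ (fun x => \sum_i f x ord0 i ^+ 2)
  (@Num.sqrt R)); last exact: sqrt_continuous.
apply: sum_continuous => i {}x; apply: (@cvgM R _ (nbhs x) _ _ _ _ _); exact: cf.
Qed.

(** Radial rescaling: [v] is sent to the vector of norm [a] in its direction,
    and [0] is sent to [0] since [0 / 0 = 0]. *)
Lemma radial_continuous (X : topologicalType) m (a : X -> R) (f : X -> 'rV[R]_m) :
  continuous a -> (forall i, continuous (fun x => f x ord0 i)) ->
  (forall x, f x = 0 -> a x = 0) ->
  continuous (fun x => (a x / row_norm (f x)) *: f x).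
Proof.
move=> ca cf af; apply: row_continuous => i x.
have [fx0|fx] := eqVneq (row_norm (f x)) 0; last first.
  under eq_fun do rewrite mxE.
  apply: (@cvgM R _ (nbhs x) _ _ _ _ _); last exact: cf.
  apply: (@cvgM R _ (nbhs x) _ _ _ _ _); first exact: ca.
  by apply: cvgV => //; exact: row_norm_continuous.
(* At a zero of [f] the quotient need not be continuous, but every coordinate of the rescaled vector
   is bounded by [a] in absolute value, and [a] tends to 0 there. *)
have ax0 : a x = 0 by apply: af; exact: row_norm_eq0.
rewrite /continuous_at mxE (row_norm_eq0 fx0) mxE mulr0.
apply/cvgr0Pnorm_lt => e e0.
have /cvgr0Pnorm_lt/(_ e e0) : a y @[y --> x] --> (0 : R) by rewrite -ax0; exact: ca.
apply: filterS => y; apply: le_lt_trans.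
rewrite mxE -mulrA normrM ler_piMr // normrM.
have [fy0|fy] := eqVneq (row_norm (f y)) 0; first by rewrite fy0 invr0 normr0 mul0r.
have fy_gt0 : 0 < row_norm (f y) by rewrite lt_def fy row_norm_ge0.
rewrite normfV (ger0_norm (row_norm_ge0 _)) mulrC ler_pdivrMr // mul1r.
exact: row_norm_coord.
Qed.

Context (T : finType) (adj : rel T) (adj_sym : symmetric adj).
Hypothesis connT : cut_connected adj finset.setT.
Context d (P : finPOrderType d) (tub : P -> {set {set T}}).
Hypothesis tub_le : forall p q, (p <= q)%O = (tub q \subset tub p).
Hypothesis tub_tubing : forall p, tubing adj (tub p).
Hypothesis tub_surj : forall s, tubing adj s -> exists p, tub p = s.

Local Notation F := (@depth_sum T R d P tub).

Lemma depth_sumE (x y : P -> R) r pe : tub pe = finset.set0 ->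
  (forall p, p != pe -> x p = r * y p) -> forall g, F x g = r * F y g.
Proof.
move=> tpe xy g; rewrite /depth_sum mulr_sumr; apply: eq_bigr => p _.
have [->|/xy ->] := eqVneq p pe; last by rewrite mulrA.
rewrite /depth tpe big1 ?mulr0 // => I.
by rewrite finset.in_set0.
Qed.

Lemma drop_chain_weight (x : P -> R) r pe : 0 <= r -> chain_weight 1 x ->
  chain_weight (r * (1 - x pe)) (fun p => if p == pe then 0 else r * x p).
Proof.
move=> r0 [x0 x1 xch]; split.
- by move=> p; case: ifP => // _; rewrite mulr_ge0.
- have -> : 1 - x pe = \sum_(p | p != pe) x p.
    by rewrite -x1 (bigD1 pe) //= addrAC subrr add0r.
  rewrite (bigD1 pe) //= eqxx add0r mulr_sumr.
  by apply: eq_bigr => p /negPf ->.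
- move=> p q; case: ifP => _; rewrite ?eqxx //; case: ifP => _; rewrite ?eqxx //.
  by rewrite !mulf_eq0 !negb_or => /andP[_ xp] /andP[_ xq]; exact: xch.
Qed.

(** The empty tubing [pe] is the top of [P] and goes to the centre. The radius of a point is its
    total weight away from [pe], and its direction is its depth function modulo constants. *)
Theorem tubing_disc : (0 < #|T|)%N ->
  homeomorphic (realization R P) (closed_disc R #|T|.-1).
Proof.
case/card_gt0P => t0 _.
have [pe tpe] : exists p, tub p = finset.set0.
  by apply: tub_surj; split=> I; rewrite finset.in_set0.
have -> : #|T|.-1 = #|predC1 t0| by rewrite cardC1.
set m := #|predC1 t0|; pose c (i : 'I_m) : T := enum_val i.
have cP g : g != t0 -> exists i, c i = g.
  move=> gt0; have gA : g \in predC1 t0 by [].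
  by exists (enum_rank_in gA g); rewrite /c enum_rankK_in.
(* Values relative to the base vertex [t0] are coordinates on functions modulo constants; [c] lists
   the other vertices, whence the dimension [#|T|.-1]. *)
pose E (x : realization R P) : 'rV[R]_m :=
  \row_i (F (weight x) (c i) - F (weight x) t0).
have EE x i : E x ord0 i = F (weight x) (c i) - F (weight x) t0 by rewrite mxE.
have E_cont i : continuous (fun x => E x ord0 i).
  have cF g : continuous (fun x : realization R P => F (weight x) g).
    apply: sum_continuous => p x; apply: (@cvgM R _ (nbhs x) _ _ _ _ _).
      exact: weight_continuous.
    exact: cvg_cst.
  move=> x; under eq_fun do rewrite mxE.
  by apply: (@cvgB R R _ (nbhs x)); exact: cF.
have E_scale x y r : E x = r *: E y -> forall j k,
    F (weight x) j - F (weight x) k = r * F (weight y) j - r * F (weight y) k.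
  move=> xy; have H j : F (weight x) j - F (weight x) t0 =
      r * F (weight y) j - r * F (weight y) t0.
    have [->|/cP[i <-]] := eqVneq j t0; first by rewrite !subrr.
    by rewrite -EE xy mxE EE mulrBr.
  move=> j k; have := congr2 (fun u v : R => u - v) (H j) (H k).
  by rewrite !opprB !addrA !subrK.
(* Proportional images come from proportional weights away from [pe]: both weights are cleared at
   [pe] and compared by [depth_sum_inj], which allows different masses. *)
have rigid x y r : 0 <= r -> E x = r *: E y ->
    forall p, p != pe -> weight x p = r * weight y p.
  move=> r0 xy p ppe.
  have hx := drop_chain_weight pe ler01 (chain_weight_of_realization x).
  have hy := drop_chain_weight pe r0 (chain_weight_of_realization y).
  have := depth_sum_inj tub_le tub_tubing connT tpe hx hy.
  rewrite eqxx => /(_ erefl) H.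
  have FE z s g : F (fun q => if q == pe then 0 else s * z q) g = s * F z g.
    by apply: depth_sumE tpe _ g => q /negPf ->.
  have /H/(_ p) : forall j k, F (fun q => if q == pe then 0 else 1 * weight x q) j -
     F (fun q => if q == pe then 0 else 1 * weight x q) k =
     F (fun q => if q == pe then 0 else r * weight y q) j -
     F (fun q => if q == pe then 0 else r * weight y q) k.
    by move=> j k; rewrite !FE !mul1r; exact: E_scale.
  by rewrite /= (negPf ppe) mul1r.
have sum_pe (x : realization R P) : \sum_(p | p != pe) weight x p = 1 - weight x pe.
  by case: (weightP x) => _ <- _; rewrite [in RHS](bigD1 pe) //= addrAC subrr add0r.
(* Rigidity is applied to the point itself with factor 0. *)
have E0 x : E x = 0 -> 1 - weight x pe = 0.
  move=> x0; rewrite -sum_pe big1 // => p ppe.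
  by rewrite (rigid x x 0 _ _ p ppe) ?mul0r // scale0r.
pose rad (x : realization R P) := 1 - weight x pe.
have rad_ge0 x : 0 <= rad x.
  by rewrite /rad -sum_pe sumr_ge0 // => p _; case: (weightP x).
have rad_le1 x : rad x <= 1.
  by rewrite /rad gerBl; case: (weightP x).
pose G0 x := (rad x / row_norm (E x)) *: E x.
have G0_norm x : row_norm (G0 x) = rad x.
  rewrite row_normZ ?divr_ge0 ?row_norm_ge0 //.
  have [/row_norm_eq0/E0 r0|E0'] := eqVneq (row_norm (E x)) 0.
    by rewrite /rad r0 !mul0r.
  by rewrite divfK.
have G_in x : G0 x \in [set v : 'rV[R]_m | \sum_i v ord0 i ^+ 2 <= 1].
  by rewrite inE /= -row_norm_sqr G0_norm expr_le1.
pose G x : closed_disc R m := exist _ (G0 x) (G_in x).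
have G_cont : continuous G.
  apply: set_type_continuous; apply: radial_continuous => // x.
  by apply: (@cvgB R R _ (nbhs x)); [exact: cvg_cst|exact: weight_continuous].
have G_inj : injective G.
  move=> x y /(congr1 sval); rewrite /= => Gxy.
  have rxy : rad x = rad y by rewrite -!G0_norm Gxy.
  have pexy : weight x pe = weight y pe.
    by rewrite -[LHS](subKr 1) -[RHS](subKr 1) -/(rad x) -/(rad y) rxy.
  have [r0|rN0] := eqVneq (rad x) 0.
    apply: realization_eq => p; have [->//|ppe] := eqVneq p pe.
    have z0 z : rad z = 0 -> weight z p = 0.
      move=> /eqP; rewrite /rad -sum_pe psumr_eq0 => [/allP/(_ p)|q _].
        by rewrite mem_index_enum ppe => /(_ isT)/eqP.
      by case: (weightP z).
    by rewrite !z0 // -rxy.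
  have nE z : rad z != 0 -> 0 < row_norm (E z).
    move=> rz; rewrite lt_def row_norm_ge0 andbT; apply: contra rz => /eqP.
    by move=> /row_norm_eq0/E0 z0; rewrite /rad z0.
  have nx := nE x rN0; have ny : 0 < row_norm (E y) by apply: nE; rewrite -rxy.
  pose r := row_norm (E x) / row_norm (E y).
  have r_ge0 : 0 <= r by rewrite divr_ge0 ?row_norm_ge0.
  have Exy : E x = r *: E y.
    move: Gxy => /(congr1 (fun v => (row_norm (E x) / rad x) *: v)).
    rewrite /G0 -rxy !scalerA mulrA divfK // divff ?gt_eqF // scale1r => ->.
    by congr (_ *: _); rewrite mulrA divfK.
  have xy := rigid _ _ _ r_ge0 Exy.
  (* Equal radii mean equal total mass away from [pe], so the proportionality factor is 1. *)
  have r1 : r = 1.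
    apply: (mulIf rN0); rewrite mul1r {1}rxy /rad -!sum_pe mulr_sumr.
    by apply/esym/eq_bigr => p; exact: xy.
  apply: realization_eq => p; have [->//|/xy] := eqVneq p pe.
  by rewrite r1 mul1r.
have G_surj v : exists x, G x = v.
  case: v => v v_in; have v_le1 : row_norm v <= 1.
    rewrite -(@expr_le1 _ 2) ?row_norm_ge0 // row_norm_sqr.
    by move: v_in; rewrite inE.
  pose h g := \sum_i v ord0 i * (c i == g)%:R.
  have c_inj : injective c by exact: enum_val_inj.
  have hc i : h (c i) = v ord0 i.
    rewrite /h (bigD1 i) //= eqxx mulr1 big1 ?addr0 // => j.
    by rewrite -(inj_eq c_inj) => /negPf ->; rewrite mulr0.
  have ht0 : h t0 = 0.
    rewrite /h big1 // => i _; have := enum_valP i; rewrite inE /= => /negPf.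
    by rewrite -/(c i) => ->; rewrite mulr0.
  have [x0 [[x0_ge0 _ x0ch] x0pe x0F]] :=
    depth_sum_surj adj_sym tub_le tub_surj connT h tpe.
  pose M := \sum_p x0 p.
  have M_ge0 : 0 <= M by exact: sumr_ge0.
  pose r := row_norm v / M.
  have r_ge0 : 0 <= r by rewrite divr_ge0 ?row_norm_ge0.
  have rM : r * M = row_norm v.
    (* If [M] is 0 then [x0] vanishes, [h] is constantly equal to [h t0], which is 0, and so [v] is
       0. *)
    have [M0|M0] := eqVneq M 0; last by rewrite /r divfK.
    suff -> : v = 0 by rewrite row_norm0 M0 mulr0.
    have x00 p : x0 p = 0.
      by move/eqP: M0; rewrite psumr_eq0 // => /allP/(_ p);
        rewrite mem_index_enum => /(_ isT)/eqP.
    apply/rowP => i; rewrite mxE -hc -[LHS]subr0 -ht0 -x0F /depth_sum.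
    by rewrite !big1 ?subrr // => p _; rewrite x00 mul0r.
  (* Scaling [x0] to mass [row_norm v] gives the right radius, and the remaining mass goes to
     [pe]. *)
  pose x p := r * x0 p + (1 - row_norm v) * (p == pe)%:R.
  have xpe : x pe = 1 - row_norm v by rewrite /x x0pe mulr0 add0r eqxx mulr1.
  have xE p : p != pe -> x p = r * x0 p.
    by move=> /negPf pp; rewrite /x pp mulr0 addr0.
  have hx : realization_set (x : prod_topology (fun _ : P => R)).
    split.
    - by move=> p; apply: addr_ge0; apply: mulr_ge0; rewrite ?subr_ge0 ?ler0n.
    - rewrite big_split /= -mulr_sumr -/M rM -mulr_sumr.
      have -> : \sum_p (p == pe)%:R = 1 :> R.
        by rewrite (bigD1 pe) //= eqxx big1 ?addr0 // => p /negPf ->.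
      by rewrite mulr1 addrC subrK.
    - have pe_top p : (p <= pe)%O by rewrite tub_le tpe finset.sub0set.
      move=> p q; have [->|pp] := eqVneq p pe.
        by move=> _ _; rewrite /Order.comparable pe_top orbT.
      have [->|qq] := eqVneq q pe; first by rewrite /Order.comparable pe_top.
      rewrite !xE // !mulf_eq0 !negb_or => /andP[_ xp] /andP[_ xq].
      exact: x0ch.
  exists (exist _ x (mem_set hx)); apply: val_inj => /=.
  rewrite /G0 (_ : E _ = r *: v); last first.
    apply/rowP => i; rewrite EE !mxE -(hc i) -[h _]subr0 -ht0 -x0F mulrBr.
    by rewrite !(depth_sumE tpe xE).
  rewrite /rad /weight /= xpe subKr row_normZ // scalerA.
  have [v0|v0] := eqVneq (row_norm v) 0.
    by rewrite (row_norm_eq0 v0) scaler0.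
  have r0 : r != 0 by apply: contra_neq v0 => r0; rewrite -rM r0 mul0r.
  by rewrite mulrC mulrA divff ?scale1r // mulf_neq0.
have GK v : {x | G x = v} by exact: cid.
pose G' v := sval (GK v).
have G'K : cancel G' G by move=> v; rewrite /G'; case: (GK v).
have KG' : cancel G G' by move=> x; apply: G_inj; rewrite G'K.
exists G, G'; split=> //.
apply: compact_hausdorff_homeomorphic G_cont KG' G'K.
  exact: realization_compact.
by apply: set_type_hausdorff; exact: norm_hausdorff.
Qed.

End TubingDisc.

(** * Cyclohedra as discs *)

Section CycleGraph.
Context (S : finType) (sigma : S -> S).

Definition cycle_adj : rel S := fun x y => (sigma x == y) || (sigma y == x).

Lemma cycle_adj_sym : symmetric cycle_adj.
Proof. by move=> x y; rewrite /cycle_adj orbC. Qed.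

Hypothesis sigma_inj : injective sigma.
(** Distinctness of the first [#|S|] iterates makes [sigma] a single cycle. *)
Hypothesis sigma_orbit : forall x, uniq (traject sigma x #|S|).

Lemma mem_orbit x y : y \in traject sigma x #|S|.
Proof.
have eqS : #|traject sigma x #|S| | = #|S|.
  by rewrite (card_uniqP (sigma_orbit x)) size_traject.
have /(subset_cardP eqS)/(_ y) -> // : traject sigma x #|S| \subset S.
by apply/fintype.subsetP.
Qed.

Lemma orbitP x y : exists2 i, (i < #|S|)%N & y = iter i sigma x.
Proof. by have /trajectP[i iS ->] := mem_orbit x y; exists i. Qed.

Lemma iter_orbit_inj x i j : (i < #|S|)%N -> (j < #|S|)%N ->
  iter i sigma x = iter j sigma x -> i = j.
Proof.
move=> iS jS; rewrite -(nth_traject sigma iS) -(nth_traject sigma jS) => /eqP.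
by rewrite nth_uniq ?size_traject // => /eqP.
Qed.

Definition arc x m : {set S} := finset (mem (traject sigma x m)).

Lemma mem_arc x m y :
  reflect (exists2 i, (i < m)%N & y = iter i sigma x) (y \in arc x m).
Proof. by rewrite finset.inE; exact: trajectP. Qed.

(** A set that contains one position of the arc and misses another changes membership between two
    consecutive positions, which are adjacent. *)
Lemma arc_connected x m : cut_connected cycle_adj (arc x m).
Proof.
have step (B : pred S) k i : (i + k < m)%N ->
    B (iter i sigma x) != B (iter (i + k) sigma x) ->
    exists2 j, (j.+1 < m)%N & B (iter j sigma x) != B (iter j.+1 sigma x).
  elim: k i => [|k IHk] i; first by rewrite addn0 eqxx.
  rewrite addnS => ikm Bik.
  have [Bi|Bi] := eqVneq (B (iter i sigma x)) (B (iter i.+1 sigma x)).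
    by apply: (IHk i.+1); rewrite ?addSn // -Bi.
  by exists i => //; apply: leq_ltn_trans ikm; rewrite ltnS leq_addr.
move=> B [_ /mem_arc[i im ->] iB] [_ /mem_arc[k km ->] kB].
have [j jm Bj] : exists2 j, (j.+1 < m)%N &
    (iter j sigma x \in B) != (iter j.+1 sigma x \in B).
  have [ik|ki] := leqP i k.
    by apply: (step (mem B) (k - i)%N i); rewrite subnKC //= iB (negPf kB).
  by apply: (step (mem B) (i - k)%N k); rewrite (subnKC (ltnW ki)) //= iB (negPf kB).
have jA : iter j sigma x \in arc x m by apply/mem_arc; exists j => //; exact: ltnW.
have jA' : iter j.+1 sigma x \in arc x m by apply/mem_arc; exists j.+1.
have adj1 : cycle_adj (iter j sigma x) (iter j.+1 sigma x).
  by rewrite /cycle_adj /= eqxx.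
have [jB|jB] := boolP (iter j sigma x \in B).
  exists (iter j sigma x), (iter j.+1 sigma x); split=> //.
  by apply: contraNN Bj; rewrite jB => ->.
exists (iter j.+1 sigma x), (iter j sigma x); split=> //; last first.
  by rewrite cycle_adj_sym.
by apply: contraNT Bj => /negPf ->; rewrite (negPf jB).
Qed.

Lemma cycle_connected : cut_connected cycle_adj finset.setT.
Proof.
case: (pickP [pred x : S | true]) => [x _|S0]; last by move=> B [j]; have := S0 j.
have -> : finset.setT = arc x #|S|.
  by apply/setP => y; rewrite !finset.inE mem_orbit.
exact: arc_connected.
Qed.

Lemma arc_tube x m : (0 < m < #|S|)%N -> tube cycle_adj (arc x m).
Proof.
case/andP=> m0 mS; split; last exact: arc_connected.
  by apply/finset.set0Pn; exists x; apply/mem_arc; exists 0%N.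
apply/negP => /eqP/setP/(_ (iter m sigma x)); rewrite finset.in_setT.
move=> /mem_arc[i im /iter_orbit_inj mi].
by have := im; rewrite -mi ?ltnn //; exact: ltn_trans im mS.
Qed.

(** Walk along the cycle from a vertex outside [A]: the arc starts where [A] is first entered and
    stops just before it is next left. *)
Lemma tube_arc A : tube cycle_adj A ->
  exists x m, (0 < m < #|S|)%N /\ A = arc x m.
Proof.
move=> [A0 AT cA]; have [a aA] := finset.set0Pn _ A0.
have /subsetPn[k _ kA] : ~~ (finset.setT \subset A) by rewrite finset.subTset.
have ex_i : exists i, iter i sigma k \in A.
  by have [i _ aE] := orbitP k a; exists i; rewrite -aE.
case: (ex_minnP ex_i) => -[|i] iA imin; first by rewrite /= (negPf kA) in iA.
pose t := iter i sigma k; pose x := sigma t.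
have tA : t \notin A by apply/negP => /imin; rewrite ltnn.
have [l0 l0S l0E] := orbitP x t.
have ex_l : exists l, iter l sigma x \notin A by exists l0; rewrite -l0E.
case: (ex_minnP ex_l) => l lA lmin.
have lS : (l < #|S|)%N by apply: leq_ltn_trans l0S; apply: lmin; rewrite -l0E.
have l_gt0 : (0 < l)%N by case: (l) lA => //; rewrite /= iA.
exists x, l; split; first by rewrite l_gt0.
have sub : arc x l \subset A.
  apply/fintype.subsetP => _ /mem_arc[j jl ->]; apply: contraLR jl => /lmin.
  by rewrite -leqNgt.
apply/eqP; rewrite finset.eqEsubset sub andbT; apply: contraT => /subsetPn[b bA bl].
(* An edge of [A] leaving the arc would leave it at an end, but the vertices [t] and
   [iter l sigma x] just outside the two ends are not in [A]. *)
have [||_ [c [_ /mem_arc[j jl ->] cA' cl /orP[/eqP jc|/eqP cj]]]] := cA (arc x l).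
- by exists x => //; apply/mem_arc; exists 0%N.
- by exists b.
- case/negP: cl; apply/mem_arc; exists j.+1; last by rewrite -jc.
  rewrite ltn_neqAle jl andbT; apply: contraNneq lA => <-.
  by rewrite /= jc.
case: j jl cj => [|j] jl /= /sigma_inj cj; first by rewrite -cj cA' in tA.
by case/negP: cl; apply/mem_arc; exists j => //; exact: ltnW.
Qed.

(** The elements [s] of a bracket stand for the gaps between [s] and its
    successor; the bracket spans the gaps at all its elements but the last. *)
Definition inner (b : seq S) : {set S} :=
  finset (fun s => (s \in b) && (s != last s b)).

Lemma inner_traject x m : (m < #|S|)%N -> inner (traject sigma x m.+1) = arc x m.
Proof.
move=> mS; apply/setP => s; rewrite finset.inE; apply/andP/mem_arc.
  rewrite trajectSr mem_rcons last_rcons inE => -[/orP[->//|]].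
  by move=> /trajectP[i im ->] _; exists i.
move=> [i im ->]; rewrite trajectSr last_rcons mem_rcons inE; split.
  by apply/orP; right; apply/trajectP; exists i.
apply/negP => /eqP /iter_orbit_inj E; have := im; rewrite -E ?ltnn //.
exact: ltn_trans im mS.
Qed.

(** Here [m] counts the gaps spanned. The value [#|S| - 1] gives the brackets on all of [S], one for
    each starting point. *)
Definition sigma_bracket (b : seq S) : Prop :=
  exists x m, (0 < m < #|S|)%N /\ b = traject sigma x m.+1.

Lemma sigma_bracket_uniq b : sigma_bracket b -> uniq b.
Proof.
move=> [x [m [/andP[_ mS] ->]]].
by rewrite -(take_traject sigma x mS) take_uniq.
Qed.

Lemma inner_succ b s : sigma_bracket b -> s \in inner b -> sigma s \in b.
Proof.
move=> [x [m [/andP[_ mS] ->]]]; rewrite inner_traject // => /mem_arc[i im ->].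
by apply/trajectP; exists i.+1.
Qed.

Lemma inner_mem b s : s \in inner b -> s \in b.
Proof. by rewrite finset.inE => /andP[]. Qed.

Lemma inner_pred b s : sigma_bracket b -> s \in b -> s \notin inner b ->
  exists2 t, t \in inner b & sigma t = s.
Proof.
move=> [x [m [/andP[m0 mS] ->]]]; rewrite inner_traject // => /trajectP[i im sE].
have [iE|] : i = m \/ s \in arc x m; last by move=> ->.
  move: im; rewrite ltnS leq_eqVlt => /orP[/eqP ->|im]; first by left.
  by right; apply/mem_arc; exists i.
move=> _; rewrite sE iE; case: (m) m0 => // k _; exists (iter k sigma x) => //.
by apply/mem_arc; exists k.
Qed.

Lemma inner_infix b c : uniq c -> b != [::] -> infix b c ->
  inner b \subset inner c.
Proof.
move=> uc b0 bc; apply/fintype.subsetP => s; rewrite !finset.inE => /andP[sb sl].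
rewrite (mem_infix bc sb) /=; case/infixP: bc => u [v cE].
case/lastP: v cE => [|v z] cE.
  by rewrite cE cats0 last_cat; case: (b) b0 sl.
rewrite cE catA last_cat last_rcons; apply: contraTneq uc => sz.
rewrite cE catA cat_uniq; apply/and3P => -[_ /hasPn/(_ z) + _].
by rewrite /= mem_rcons mem_head mem_cat -sz sb orbT => /(_ isT).
Qed.

(** Containment of arcs places the start of [b] at position [i] of [c]. If the arc of [b] overran
    that of [c], it would contain the last element of [c], at position [k], which is not in the arc
    of [c]; so [i + m] is at most [k]. *)
Lemma inner_sub b c : sigma_bracket b -> sigma_bracket c ->
  infix b c = (inner b \subset inner c).
Proof.
move=> hb hc; apply/idP/idP => [bc|].
  apply: (inner_infix (sigma_bracket_uniq hc) _ bc).
  by case: hb => x [m [_ ->]].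
case: hb hc => [x [m [/andP[m0 mS] ->]]] [y [k [/andP[k0 kS] ->]]].
rewrite !inner_traject // => /fintype.subsetP sub.
have /sub/mem_arc[i ik xE] : x \in arc x m by apply/mem_arc; exists 0%N.
have imk : (i + m <= k)%N.
  rewrite leqNgt; apply/negP => kim.
  have /sub/mem_arc[j jk jE] : iter k sigma y \in arc x m.
    apply/mem_arc; exists (k - i)%N; first by rewrite ltn_subLR // ltnW.
    by rewrite xE -iterD subnK // ltnW.
  have kj := iter_orbit_inj kS (ltn_trans jk kS) jE.
  by rewrite kj ltnn in jk.
apply/infixP; exists (traject sigma y i).
exists (traject sigma (iter m.+1 sigma x) (k - (i + m))).
by rewrite xE -!trajectD; congr traject; lia.
Qed.

(** For each element of a bracket, the gap at it or the gap just before it belongs to the arc, so a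
    common element makes two arcs meet or touch. Conversely both ends of every gap in an arc belong
    to the bracket, so arcs that meet or touch come from brackets sharing an element. *)
Lemma disjoint_or_infix_tubes b c : sigma_bracket b -> sigma_bracket c ->
  disjoint_or_infix b c <-> tubes_compatible cycle_adj (inner b) (inner c).
Proof.
move=> hb hc; rewrite /disjoint_or_infix !inner_sub //; split.
  case/or3P => [/hasPn bc|bc|cb]; [apply: Or33|exact: Or31|exact: Or32].
  move=> i j ib jc.
  have nb s : s \in b -> s \in c -> False by move=> sb /bc; rewrite /= sb.
  split; first by apply/eqP => ij; apply: (nb i); rewrite ?ij inner_mem // -?ij.
  apply/negP => /orP[/eqP ij|/eqP ji].
    by apply: (nb j); rewrite ?(inner_mem jc) // -ij inner_succ.
  by apply: (nb i); rewrite ?(inner_mem ib) // -ji inner_succ.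
case=> [->|->|H]; rewrite ?orbT //; apply/or3P/Or31/hasPn => s sc.
apply/negP => /= sb.
have [sib|sib] := boolP (s \in inner b); have [sic|sic] := boolP (s \in inner c).
- by have [] := H _ _ sib sic; rewrite eqxx.
- have [t tc ts] := inner_pred hc sc sic.
  by have [_] := H _ _ sib tc; rewrite /cycle_adj ts eqxx orbT.
- have [t tb ts] := inner_pred hb sb sib.
  by have [_] := H _ _ tb sic; rewrite /cycle_adj ts eqxx.
- have [t tb ts] := inner_pred hb sb sib; have [t' tc ts'] := inner_pred hc sc sic.
  have [] := H _ _ tb tc; rewrite (sigma_inj (etrans ts (esym ts'))) eqxx //.
Qed.

Lemma sigma_bracket_tube b : sigma_bracket b -> tube cycle_adj (inner b).
Proof.
move=> [x [m [mS ->]]]; have [/andP[_ mS']] := (mS, mS).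
by rewrite inner_traject //; exact: arc_tube.
Qed.

Lemma tube_sigma_bracket A : tube cycle_adj A ->
  exists2 b, sigma_bracket b & inner b = A.
Proof.
move=> /tube_arc[x [m [mS ->]]]; exists (traject sigma x m.+1).
  by exists x, m.
by case/andP: mS => _ mS; exact: inner_traject.
Qed.

Lemma inner_inj b c : sigma_bracket b -> sigma_bracket c ->
  inner b = inner c -> b = c.
Proof.
move=> hb hc bc; have ib : infix b c by rewrite inner_sub // bc.
have ic : infix c b by rewrite inner_sub // bc.
have /infixP[u [v cE]] := ib; have := size_infix ic.
rewrite cE !size_cat => sz; have /size0nil u0 : size u = 0%N by lia.
have /size0nil v0 : size v = 0%N by lia.
by rewrite u0 v0 cats0.
Qed.

End CycleGraph.

(** * The successor map of a cyclic order and the cyclohedron *)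

Section Cyclohedron.
Context (S : cycSet).

(** After rotating the list to start at [x], the three elements have indices 0, 1 and at least 2. *)
Lemma cyc_enum_next (e : seq S) x z : cyc_enum e -> next e x != x ->
  z != x -> z != next e x -> cyc x (next e x) z.
Proof.
move=> he; have [eU eA _] := cyc_enumP _ he.
have [i e1 ex] := rot_to (eA x).
have := cyc_enum_rot i he; rewrite ex => he1.
have -> : next e x = next (x :: e1) x by rewrite -ex next_rot.
have [eU1 eA1 ->] := cyc_enumP _ he1.
case: e1 {ex he1} eU1 eA1 => [|y e1] eU1 eA1; rewrite /= eqxx ?eqxx //.
move=> yx zx zy; rewrite [x == y]eq_sym (negPf yx).
by rewrite [x == z]eq_sym (negPf zx) [y == z]eq_sym (negPf zy).
Qed.

(** If the two successors of [x] differed, each would precede the other when counting from [x],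
    against asymmetry. A fixed [x] occurs only in a one-element set. *)
Lemma cyc_enum_next_uniq (e e' : seq S) : cyc_enum e -> cyc_enum e' ->
  next e =1 next e'.
Proof.
move=> he he' x; apply/eqP; apply: contraT => ne.
have size1 (e1 e2 : seq S) : cyc_enum e1 -> cyc_enum e2 -> next e1 x = x ->
    next e2 x = x.
  move=> he1 he2; have [eU eA _] := cyc_enumP _ he1.
  have [i e3 ex] := rot_to (eA x).
  rewrite -(next_rot i) // ex; case: e3 ex => [|y e3] ex /=; rewrite eqxx.
    move=> _; have := eA (next e2 x); rewrite -(mem_rot i) ex mem_seq1.
    by move/eqP.
  by move=> yx; have := eU; rewrite -(rot_uniq i) ex yx /= mem_head.
have nx : next e x != x.
  by apply: contraNneq ne => nx; rewrite nx (size1 _ _ he he' nx).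
have nx' : next e' x != x.
  by apply: contraNneq ne => nx'; rewrite nx' (size1 _ _ he' he nx').
have h1 := cyc_enum_next he nx nx' _; have h2 := cyc_enum_next he' nx' nx _.
by have := cyc_asym (h1 _); rewrite h2 // eq_sym => /(_ ne).
Qed.

Lemma eq_traject (f g : S -> S) x n : f =1 g -> traject f x n = traject g x n.
Proof. by move=> fg; elim: n x => //= n IHn x; rewrite fg IHn. Qed.

Lemma cyc_enum_traject (e : seq S) x : cyc_enum (x :: e) ->
  x :: e = traject (next (x :: e)) x #|S|.
Proof.
move=> he; have [eU _ _] := cyc_enumP _ he; rewrite -(cyc_enum_size he).
have := cycle_next eU; rewrite /= rcons_path => /andP[/fpathE eE _].
by congr (_ :: _); exact: eE.
Qed.

Lemma homeomorphic_cyclohedron (R : realType) : (0 < #|S|)%N ->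
  homeomorphic (cyclohedron R S) (closed_disc R #|S|.-1).
Proof.
move=> S0; have [e he] := cyc_enum_exists S; have [eU eA _] := cyc_enumP _ he.
pose sigma := next e.
have sigma_inj : injective sigma by exact: can_inj (prev_next eU).
have trE x e' : cyc_enum (x :: e') -> x :: e' = traject sigma x #|S|.
  move=> he'; rewrite {1}(cyc_enum_traject he'); apply: eq_traject.
  exact: cyc_enum_next_uniq.
have sigma_orbit x : uniq (traject sigma x #|S|).
  have [e' he'] := cyc_enum_cons x.
  by rewrite -(trE _ _ he'); have [] := cyc_enumP _ he'.
have br_sigma (b : #|S|.-bseq S) : cyc_bracket b -> sigma_bracket sigma b.
  move=> /cyc_bracketP[b1 [e1 he1 /infixP[u [v e1E]]]].
  have := cyc_enum_rot (size u) he1; rewrite e1E rot_size_cat => he2.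
  have bn : (size b <= #|S|)%N by exact: size_bseq.
  have [x [b' bE]] : exists x b', b = x :: b' :> seq S.
    by case: (b : seq S) b1 => // x b' _; exists x, b'.
  exists x, (size b).-1; split; first by case: (size b) b1 bn => [|[]].
  rewrite prednK; last exact: ltnW.
  rewrite -(take_traject sigma x bn) -(trE x (b' ++ v ++ u)).
    by rewrite -cat_cons -bE take_size_cat.
  by rewrite -cat_cons -bE catA.
have sigma_br b : sigma_bracket sigma b ->
    exists2 b' : #|S|.-bseq S, b' = b :> seq S & cyc_bracket b'.
  move=> [x [m [/andP[m0 mS] bE]]].
  have sb : (size b <= #|S|)%N by rewrite bE size_traject.
  exists (Bseq sb) => //; apply/cyc_bracketP; split.
    by rewrite /= bE size_traject.
  have [e' he'] := cyc_enum_cons x; exists (x :: e') => //.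
  suff : infix b (x :: e') by [].
  by rewrite bE (trE _ _ he') -(take_traject sigma x mS); exact: infix_take.
pose tub (p : W_poset S) : {set {set S}} :=
  finset.imset (fun b : #|S|.-bseq S => inner b) (mem (val p)).
have valW (p : W_poset S) b : b \in val p -> sigma_bracket sigma b.
  by have /cyc_bracketingP[H _] := valP p => /H; exact: br_sigma.
have mem_tub (p : W_poset S) (b : #|S|.-bseq S) : sigma_bracket sigma b ->
    (inner b \in tub p) = (b \in val p).
  move=> hb; apply/imsetP/idP => [[b' b'p bb']|bp]; last by exists b.
  suff -> : b = b' by [].
  by apply: val_inj; apply: (inner_inj sigma_orbit hb (valW _ _ b'p)).
apply: (@tubing_disc R S _ (cycle_adj_sym sigma) (cycle_connected sigma_orbit)
  _ (W_poset S) tub) => //.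
- move=> p q; apply/idP/idP => [pq|/fintype.subsetP qp]; first exact: finset.imsetS.
  apply/fintype.subsetP => b bq; have hb := valW _ _ bq.
  by rewrite -mem_tub // qp // mem_tub.
- move=> p; split=> [I /imsetP[b bp ->]|I J /imsetP[b bp ->] /imsetP[c cp ->]].
    by apply: sigma_bracket_tube (valW _ _ bp).
  apply/(disjoint_or_infix_tubes sigma_inj sigma_orbit (valW _ _ bp) (valW _ _ cp)).
  by have /cyc_bracketingP[_] := valP p; exact.
- move=> s [s1 s2].
  (* Every tube is the arc of some bracket, so collecting the brackets with arcs in [s] recovers
     [s]. *)
  pose p := finset (fun b : #|S|.-bseq S => cyc_bracket b && (inner b \in s)).
  have hp : cyc_bracketing p.
    apply/cyc_bracketingP; split=> [b|b c]; rewrite !finset.inE; first by case/andP.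
    move=> /andP[/br_sigma hb bs] /andP[/br_sigma hc cs].
    by apply/(disjoint_or_infix_tubes sigma_inj sigma_orbit hb hc); exact: s2.
  exists (exist _ p hp); apply/setP => I; apply/imsetP/idP => [[b]|Is].
    by rewrite finset.inE => /andP[_ bs] ->.
  have [b hb bI] := tube_sigma_bracket sigma_inj sigma_orbit (s1 _ Is).
  have [b' b'E hb'] := sigma_br _ hb; exists b'; rewrite ?b'E //.
  by rewrite finset.inE hb' b'E bI.
Qed.

End Cyclohedron.

(** * The enriched category and the presheaf *)

(** Neighbourhoods in a summand are neighbourhoods in the coproduct, so continuity can be checked on
    products of summands. *)
Lemma sigT_pair_continuous (I J : choiceType) (X : I -> topologicalType)
    (Y : J -> topologicalType) (Z : topologicalType)
    (F : {i & X i} * {j & Y j} -> Z) :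
  (forall i j, continuous (fun xy : X i * Y j =>
    F (existT _ i xy.1, existT _ j xy.2))) -> continuous F.
Proof.
move=> cF [[i x] [j y]] U /(cF i j (x, y)) [[A B] [/= nA nB] AB].
exists (existT _ i @` A, existT _ j @` B).
  by split; exact: existT_nbhs.
by move=> [_ _] [/= [x' Ax' <-] [y' By' <-]]; exact: (AB (x', y')).
Qed.

Lemma pair_sigT_continuous (X : topologicalType) (J : choiceType)
    (Y : J -> topologicalType) (Z : topologicalType) (F : X * {j & Y j} -> Z) :
  (forall j, continuous (fun xy : X * Y j => F (xy.1, existT _ j xy.2))) ->
  continuous F.
Proof.
move=> cF [x [j y]] U /(cF j (x, y)) [[A B] [/= nA nB] AB].
exists (A, existT _ j @` B); first by split => //; exact: existT_nbhs.
by move=> [x' _] [/= Ax' [y' By' <-]]; exact: (AB (x', y')).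
Qed.

Lemma continuous_k_continuous (X Y : topologicalType) (g : X -> Y) :
  continuous g -> k_continuous g.
Proof.
by move=> cg C h _ ch x; apply: continuous_comp; [exact: ch|exact: cg].
Qed.

(** * Unit and associativity laws for substitution of bracketings *)

Section Brackets.
Context (S T : cycSet).

Lemma dChom_eq (f f' : dChom S T) : fib f =1 fib f' -> f = f'.
Proof.
move=> ff'; have ffE : (val f).2 = (val f').2 by apply/ffunP => t; exact: ff'.
apply: val_inj; rewrite [LHS]surjective_pairing [RHS]surjective_pairing ffE.
congr pair; apply/ffunP => s; apply/eqP; rewrite eq_sym.
by rewrite -[_ == _](mem_fib f') -ff' mem_fib.
Qed.

Lemma lin_bracket_card (l : seq S) (B : {set S}) : uniq l ->
  {subset B <= l} -> size [seq s <- l | s \in B] = #|B|.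
Proof.
move=> ul Bl; rewrite -(card_uniqP (filter_uniq _ ul)); apply: eq_card => s.
by rewrite mem_filter andbC; case: (boolP (s \in B)) => [/Bl ->|]; rewrite ?andbF.
Qed.

Lemma fib_preimset (f : dChom S T) t :
  finset (mem (fib f t)) = dCmap f @^-1: finset.set1 t.
Proof. by apply/setP => s; rewrite !finset.inE mem_fib. Qed.

Lemma filter_fib (f : dChom S T) t (B : {set S}) (C : seq T) :
  uniq C -> t \in C -> {subset B <= fib f t} ->
  [seq s <- preim_seq f C | s \in B] = [seq s <- fib f t | s \in B].
Proof.
move=> uC tC Bt; transitivity [seq s <- [seq s <- preim_seq f C |
    dCmap f s \in pred1 t] | s \in B].
  rewrite -filter_predI; apply: eq_filter => s /=; rewrite inE.
  by case: (boolP (s \in B)) => //= /Bt; rewrite mem_fib => ->.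
rewrite filter_preim (eq_filter (a2 := pred1 t)) //.
by rewrite filter_pred1_uniq // preim1.
Qed.

Lemma K_poset_sub (l : seq S) (p : K_poset l) B : B \in val p ->
  [/\ {subset B <= l}, (1 < #|B|)%N & (#|B| < size l)%N].
Proof.
have /lin_bracketingP[pl _] := valP p.
by move=> /pl/and3P[/fintype.subsetP Bl _ /andP[]].
Qed.

Lemma K_poset1 (s : S) (p : K_poset [:: s]) : val p = finset.set0.
Proof.
apply/setP => B; rewrite finset.in_set0; apply/negP => /K_poset_sub[_ B1 B2].
by move: (leq_trans B1 B2).
Qed.

End Brackets.

Section SubstMem.
Context (S T U : cycSet) (g : dChom T U) (f : dChom S T).

Lemma mem_K_subst u a (B : {set S}) :
  B \in val (@K_subst S T U g f u a) <->
  [/\ (1 < #|B|)%N, B != finset (mem (fib (dC_comp g f) u)) &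
   [\/ exists2 C, C \in val a.1 & B = dCmap f @^-1: C,
       exists2 t, t \in fib g u & B = finset (mem (fib f t)) |
       exists t, B \in val (a.2 t)]].
Proof.
rewrite /= finset.inE; split.
  case/and3P => -> -> /or3P[/existsP[C /andP[Ca /eqP ->]]|
    /existsP[t /andP[tu /eqP ->]]|/existsP[t Bt]]; split=> //.
  - by apply: Or31; exists C.
  - by apply: Or32; exists t.
  - by apply: Or33; exists t.
move=> [-> ->] /= [[C Ca ->]|[t tu ->]|[t Bt]]; apply/or3P.
- by apply: Or31; apply/existsP; exists C; rewrite Ca eqxx.
- by apply: Or32; apply/existsP; exists t; rewrite tu eqxx.
- by apply: Or33; apply/existsP; exists t.
Qed.

Lemma mem_W_subst a (b : #|S|.-bseq S) :
  b \in val (@W_subst S T f a) <->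
  (1 < size b)%N /\
   [\/ exists2 C : #|T|.-bseq T, C \in val a.1 & b = preim_seq f C :> seq S,
       exists t, b = fib f t :> seq S |
       exists t, exists2 B, B \in val (a.2 t) &
         b = [seq s <- fib f t | s \in B] :> seq S].
Proof.
rewrite /= finset.inE; split.
  case/andP => -> /or3P[/existsP[C /andP[Ca /eqP ->]]|
    /existsP[t /eqP ->]|/existsP[t /existsP[B /andP[Bt /eqP ->]]]]; split=> //.
  - by apply: Or31; exists C.
  - by apply: Or32; exists t.
  - by apply: Or33; exists t, B.
move=> [-> ] /= [[C Ca /eqP bC]|[t /eqP bt]|[t [B Bt /eqP bB]]]; apply/or3P.
- by apply: Or31; apply/existsP; exists C; rewrite Ca bC.
- by apply: Or32; apply/existsP; exists t.
- by apply: Or33; apply/existsP; exists t; apply/existsP; exists B; rewrite Bt.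
Qed.

Lemma preim_comp (C : seq U) :
  preim_seq (dC_comp g f) C = preim_seq f (preim_seq g C).
Proof.
elim: C => [//|u C IHC].
rewrite -cat1s preim_cat IHC preim1 fib_comp.
by rewrite (preim_cat g) (preim_cat f) preim1.
Qed.

Lemma preimset_comp (C : {set U}) :
  dCmap (dC_comp g f) @^-1: C = dCmap f @^-1: (dCmap g @^-1: C).
Proof. by apply/setP => s; rewrite !finset.inE /dCmap /= ffunE. Qed.

End SubstMem.

(** Each fiber of the identity is a singleton, so [p] has no brackets, and the only outer member,
    the whole fiber of [f], is discarded. *)
Lemma K_subst_id_left (S T : cycSet) (f : dChom S T) u
    (p : K_poset (fib (dC_id T) u)) (q : forall t, K_poset (fib f t)) :
  val (@K_subst S T T (dC_id T) f u (p, [ffun t => q (val t)])) = val (q u).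
Proof.
have fibu : fib (dC_id T) u = [:: u] by rewrite /fib /= ffunE.
have p0 : val p = finset.set0 by move: p; rewrite fibu => p; exact: K_poset1.
have whole : fib (dC_comp (dC_id T) f) u = fib f u.
  by rewrite fib_comp fibu preim1.
apply/setP => B; apply/idP/idP.
  case/mem_K_subst => B1; rewrite whole => BW [[C]|[t]|[[t /= tu]]] /=.
  - by rewrite p0 finset.in_set0.
  - by rewrite fibu mem_seq1 => /eqP -> BE; rewrite BE eqxx in BW.
  - by rewrite ffunE /=; move: tu; rewrite fibu mem_seq1 => /eqP ->.
move=> Bq; have [Bl B1 Bs] := K_poset_sub Bq.
apply/mem_K_subst; split=> //.
  rewrite whole; apply: contraTneq Bs => ->; rewrite -leqNgt.
  by rewrite cardsE (card_uniqP (fib_uniq f u)).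
have tu : u \in fib (dC_id T) u by rewrite fibu mem_head.
by apply: Or33; exists (exist _ u tu); rewrite /= ffunE.
Qed.

(** Singleton fibers carry no brackets and are themselves too small to be kept, so only the members
    of [p] survive. *)
Lemma K_subst_id_right (S T : cycSet) (f : dChom S T) u (p : K_poset (fib f u))
    (q : forall s : {s | s \in fib f u}, K_poset (fib (dC_id S) (val s))) :
  val (@K_subst S S T f (dC_id S) u (p, [ffun s => q s])) = val p.
Proof.
have fibs s : fib (dC_id S) s = [:: s] by rewrite /fib /= ffunE.
have preimE (C : {set S}) : dCmap (dC_id S) @^-1: C = C.
  by apply/setP => s; rewrite finset.inE /dCmap /= ffunE.
have whole : fib (dC_comp f (dC_id S)) u = fib f u.
  rewrite fib_comp; elim: (fib f u) => [//|s C IHC].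
  by rewrite -cat1s preim_cat IHC preim1 fibs.
apply/setP => B; apply/idP/idP.
  case/mem_K_subst => B1; rewrite whole => BW [[C]|[t tu BE]|[[t /= tu]]] /=.
  - by rewrite preimE => Cp ->.
  - by move: B1; rewrite BE fibs (_ : finset _ = finset.set1 t) ?cards1 //;
      apply/setP => s; rewrite !finset.inE.
  - by rewrite ffunE => /K_poset_sub[_ _]; rewrite /= fibs ltnNge ltnW.
move=> Bp; have [Bl B1 Bs] := K_poset_sub Bp.
apply/mem_K_subst; split=> //.
  rewrite whole; apply: contraTneq Bs => ->; rewrite -leqNgt.
  by rewrite cardsE (card_uniqP (fib_uniq f u)).
by apply: Or31; exists B; rewrite ?preimE.
Qed.

Lemma W_subst_id (S : cycSet) (p : W_poset S)
    (q : forall s, K_poset (fib (dC_id S) s)) :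
  W_subst (p, [ffun s => q s]) = p.
Proof.
have fibs s : fib (dC_id S) s = [:: s] by rewrite /fib /= ffunE.
have preimE (C : seq S) : preim_seq (dC_id S) C = C.
  by elim: C => [//|s C IHC]; rewrite -cat1s preim_cat IHC preim1 fibs.
apply/val_inj/setP => b; apply/idP/idP.
  case/mem_W_subst => b1 [[C Cp]|[s bE]|[s [B]]].
  - by rewrite preimE => /val_inj ->.
  - by rewrite bE fibs in b1.
  - rewrite ffunE => /K_poset_sub[_ B1].
    by rewrite fibs ltnNge ltnW.
move=> bp; have /cyc_bracketingP[/(_ _ bp)/cyc_bracketP[b1 _] _] := valP p.
by apply/mem_W_subst; split=> //; apply: Or31; exists b; rewrite ?preimE.
Qed.

Section SubstAssoc.
Context (S T U : cycSet) (g : dChom T U) (f : dChom S T).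

Lemma filter_fib_preimset u (C : {set T}) :
  [seq s <- fib (dC_comp g f) u | s \in dCmap f @^-1: C] =
  preim_seq f [seq t <- fib g u | t \in C].
Proof.
rewrite fib_comp -(filter_preim f (mem C)); apply: eq_filter => s.
by rewrite finset.inE.
Qed.

(** Both sides collect the members of [p], [q] and [r] pulled back to [S], together with the fibers
    of the composite and of [f]. The two orders of substitution could differ only in what is
    discarded at the intermediate stage, and what is lost there is supplied again or is too
    small. *)
Lemma W_subst_assoc (p : W_poset U) (q : forall u, K_poset (fib g u))
    (r : forall t, K_poset (fib f t)) :
  W_subst (p, [ffun u => @K_subst _ _ _ g f u (q u, [ffun t => r (val t)])]) =
  W_subst (W_subst (p, [ffun u => q u]), [ffun t => r t]).
Proof.
have bseqT (D : seq T) : uniq D -> (size D <= #|T|)%N.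
  by move=> uD; rewrite -(card_uniqP uD) max_card.
(* [D] may be missing from the bracketing of [T] for being too short. A one-element [D] then has a
   fiber of [f] as preimage, which is a member anyway; an empty [D] has an empty preimage. *)
have red (b : #|S|.-bseq S) (D : seq T) : uniq D -> (1 < size b)%N ->
    b = preim_seq f D :> seq S ->
    ((1 < size D)%N -> forall D' : #|T|.-bseq T, D' = D :> seq T ->
       D' \in val (W_subst (p, [ffun u => q u]))) ->
    b \in val (W_subst (W_subst (p, [ffun u => q u]), [ffun t => r t])).
  move=> uD b1 bD DW; apply/mem_W_subst; split=> //=.
  case: D uD bD DW => [|t [|t' D]] uD bD DW; first by rewrite bD in b1.
    by apply: Or32; exists t; rewrite bD preim1.
  apply: Or31; exists (Bseq (bseqT _ uD)) => //.
  exact: DW.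
have uq (B : {set T}) u : uniq [seq t <- fib g u | t \in B].
  by rewrite filter_uniq ?fib_uniq.
apply/val_inj/setP => b; apply/idP/idP.
  case/mem_W_subst => b1 [[C Cp bE]|[u bE]|[u [B]]].
  - apply: (red _ (preim_seq g C)) => //; last 1 first.
    + move=> D1 D DE; apply/mem_W_subst; rewrite DE; split=> //.
      by apply: Or31; exists C.
    + have /cyc_bracketingP[/(_ _ Cp)/cyc_bracketP[_ [e he Ce]] _] := valP p.
      have [ue _ _] := cyc_enumP _ he.
      by apply/preim_uniq/(infix_uniq Ce).
    + by rewrite bE preim_comp.
  - apply: (red _ (fib g u)); rewrite ?fib_uniq // ?bE ?fib_comp //.
    by move=> D1 D DE; apply/mem_W_subst; rewrite DE; split=> //;
      apply: Or32; exists u.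
  - rewrite ffunE => /mem_K_subst[B1 BW HB] bE.
    case: HB bE => [[C /= Cq ->]|[t tu ->]|[[t tu] /=]].
    + rewrite filter_fib_preimset => bE; apply: (red _ _ (uq C u)) => //.
      move=> D1 D DE; apply/mem_W_subst; rewrite DE; split=> //.
      by apply: Or33; exists u, C; rewrite //= ffunE.
    + rewrite fib_preimset filter_fib_preimset.
      rewrite (eq_filter (a2 := pred1 t)); last by move=> t'; rewrite finset.inE.
      rewrite filter_pred1_uniq ?fib_uniq // preim1 => bE.
      by apply/mem_W_subst; split=> //; apply: Or32; exists t.
    + rewrite ffunE /= => Br; have [Bl _ _] := K_poset_sub Br.
      rewrite fib_comp (filter_fib (fib_uniq g u) tu Bl) => bE.
      apply/mem_W_subst; split=> //; apply: Or33; exists t, B => //.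
      by rewrite ffunE.
have setE l (C : {set S}) : uniq l -> {subset C <= l} ->
    (size [seq s <- l | s \in C] = #|C|)%N.
  exact: lin_bracket_card.
(* [K_subst] drops the whole fiber over [u], but [W_subst] puts it back as the member coming from
   [u]. *)
have inK u (B : {set S}) : {subset B <= fib (dC_comp g f) u} ->
    b = [seq s <- fib (dC_comp g f) u | s \in B] :> seq S -> (1 < size b)%N ->
    [\/ exists2 C, C \in val (q u) & B = dCmap f @^-1: C,
       exists2 t, t \in fib g u & B = finset (mem (fib f t)) |
       exists t : {t | t \in fib g u}, B \in val (r (val t))] ->
    b \in val (W_subst
      (p, [ffun u => @K_subst _ _ _ g f u (q u, [ffun t => r (val t)])])).
  move=> Bl bE b1 HB; apply/mem_W_subst; split=> //.
  have [BW|BW] := eqVneq B (finset (mem (fib (dC_comp g f) u))).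
    apply: Or32; exists u; rewrite bE BW; apply/all_filterP/allP => s su.
    by rewrite finset.inE.
  apply: Or33; exists u, B => //; rewrite ffunE; apply/mem_K_subst; split=> //.
    by rewrite -(setE _ _ _ Bl) ?fib_uniq // -bE.
  case: HB => [HB|HB|[t Bt]]; [exact: Or31|exact: Or32|apply: Or33].
  by exists t; rewrite /= ffunE.
have subK u (C : {set T}) : {subset C <= fib g u} ->
    {subset dCmap f @^-1: C <= fib (dC_comp g f) u}.
  by move=> Cl s; rewrite finset.inE fib_comp mem_preim; exact: Cl.
case/mem_W_subst => b1 [[D DW bE]|[t bE]|[t [B]]].
- case/mem_W_subst: DW => D1 [[C Cp DE]|[u DE]|[u [C]]].
  + apply/mem_W_subst; split=> //; apply: Or31; exists C => //.
    by rewrite preim_comp -DE.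
  + by apply/mem_W_subst; split=> //; apply: Or32; exists u;
      rewrite fib_comp -DE.
  + rewrite ffunE => Cq DE; have [Cl _ _] := K_poset_sub Cq.
    apply: (inK u (dCmap f @^-1: C)) => //; first exact: subK.
      by rewrite filter_fib_preimset -DE.
    by apply: Or31; exists C.
- have tu : t \in fib g (dCmap g t) by rewrite mem_fib.
  apply: (inK (dCmap g t) (finset (mem (fib f t)))) => //.
  + by rewrite fib_preimset; apply: subK => t'; rewrite finset.inE => /eqP ->.
  + rewrite fib_preimset filter_fib_preimset.
    rewrite (eq_filter (a2 := pred1 t)); last by move=> t'; rewrite finset.inE.
    by rewrite filter_pred1_uniq ?fib_uniq // preim1.
  + by apply: Or32; exists t.
- rewrite ffunE => Br bE; have [Bl _ _] := K_poset_sub Br.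
  have tu : t \in fib g (dCmap g t) by rewrite mem_fib.
  apply: (inK (dCmap g t) B) => //.
  + by move=> s /Bl; rewrite fib_comp mem_preim mem_fib => /eqP ->.
  + by rewrite fib_comp (filter_fib (fib_uniq g _) tu Bl).
  + by apply: Or33; exists (exist _ t tu).
Qed.

End SubstAssoc.

(** The equation is between underlying sets because the two bracketings live over fibers of
    composites that are equal but not convertible. The bookkeeping is that of [W_subst_assoc],
    except that whole fibers are discarded at the outer stage too. *)
Lemma K_subst_assoc (S T U V : cycSet) (h : dChom U V) (g : dChom T U)
    (f : dChom S T) v (p : K_poset (fib h v)) (q : forall u, K_poset (fib g u))
    (r : forall t, K_poset (fib f t)) :
  val (@K_subst _ _ _ h (dC_comp g f) v (p, [ffun u =>
    @K_subst _ _ _ g f (val u) (q (val u), [ffun t => r (val t)])])) =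
  val (@K_subst _ _ _ (dC_comp h g) f v
    (@K_subst _ _ _ h g v (p, [ffun u => q (val u)]), [ffun t => r (val t)])).
Proof.
have whole : finset (mem (fib (dC_comp h (dC_comp g f)) v)) =
    dCmap f @^-1: finset (mem (fib (dC_comp h g) v)).
  apply/setP => s; rewrite !finset.inE !mem_fib /dCmap /= !ffunE.
  by rewrite /dCmap /= ffunE.
have whole' : fib (dC_comp (dC_comp h g) f) v =
    fib (dC_comp h (dC_comp g f)) v.
  by rewrite !fib_comp preim_comp.
(* For [D] of cardinality one [B] is a fiber of [f], and an empty [D] is excluded by the size of
   [B]. Since [B] is not the whole, neither is [D]. *)
have red (B : {set S}) (D : {set T}) : (1 < #|B|)%N ->
    B != finset (mem (fib (dC_comp h (dC_comp g f)) v)) ->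
    B = dCmap f @^-1: D -> {subset D <= fib (dC_comp h g) v} ->
    ((1 < #|D|)%N -> D != finset (mem (fib (dC_comp h g) v)) ->
       D \in val (@K_subst _ _ _ h g v (p, [ffun u => q (val u)]))) ->
    B \in val (@K_subst _ _ _ (dC_comp h g) f v
    (@K_subst _ _ _ h g v (p, [ffun u => q (val u)]), [ffun t => r (val t)])).
  move=> B1 BW BE Dl DK; apply/mem_K_subst; rewrite whole'; split=> //.
  have DW : D != finset (mem (fib (dC_comp h g) v)).
    by apply: contraNneq BW => DE; rewrite BE DE whole.
  have [D1|] := ltnP 1 #|D|; first by apply: Or31; exists D => //; exact: DK.
  rewrite leq_eqVlt ltnS leqn0 => /orP[/cards1P[t Dt]|].
    by apply: Or32; exists t; rewrite ?fib_preimset -?Dt // Dl // Dt finset.set11.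
  by rewrite cards_eq0 => /eqP D0; move: B1; rewrite BE D0 preimset0 cards0.
apply/setP => B; apply/idP/idP.
  case/mem_K_subst => B1 BW [[C /= Cp BE]|[u uv BE]|[[u uv] /=]].
  - have [Cl _ _] := K_poset_sub Cp.
    apply: (red _ (dCmap g @^-1: C)) => //; first by rewrite -preimset_comp.
      by move=> t; rewrite finset.inE fib_comp mem_preim; exact: Cl.
    by move=> D1 DW; apply/mem_K_subst; split=> //; apply: Or31; exists C.
  - apply: (red _ (dCmap g @^-1: finset.set1 u)) => //.
    + by rewrite -preimset_comp BE fib_preimset.
    + by move=> t; rewrite !finset.inE fib_comp mem_preim => /eqP ->.
    + move=> D1 DW; apply/mem_K_subst; split=> //; apply: Or32; exists u => //.
      by rewrite fib_preimset.
  - rewrite ffunE /= => /mem_K_subst[_ _ [[C /= Cq BE]|[t tu BE]|[[t tu] /=]]].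
    + have [Cl _ _] := K_poset_sub Cq.
      apply: (red _ C) => //.
        move=> t /Cl; rewrite mem_fib fib_comp mem_preim => /eqP ->; exact: uv.
      move=> D1 DW; apply/mem_K_subst; split=> //; apply: Or33.
      by exists (exist _ u uv); rewrite /= ffunE.
    + apply/mem_K_subst; rewrite whole'; split=> //; apply: Or32; exists t => //.
      by rewrite fib_comp mem_preim; move: tu; rewrite mem_fib => /eqP ->.
    + rewrite ffunE /= => Br; apply/mem_K_subst; rewrite whole'; split=> //.
      apply: Or33; have tv : t \in fib (dC_comp h g) v.
        by rewrite fib_comp mem_preim; move: tu; rewrite mem_fib => /eqP ->.
      by exists (exist _ t tv); rewrite /= ffunE.
(* If [B'] is the whole fiber of the composite over [u], it is lost in the inner substitution and
   recovered as an outer member. *)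
have inK u (B' : {set S}) : u \in fib h v -> (1 < #|B'|)%N ->
    B' != finset (mem (fib (dC_comp h (dC_comp g f)) v)) ->
    [\/ exists2 C, C \in val (q u) & B' = dCmap f @^-1: C,
       exists2 t, t \in fib g u & B' = finset (mem (fib f t)) |
       exists t : {t | t \in fib g u}, B' \in val (r (val t))] ->
    B' \in val (@K_subst _ _ _ h (dC_comp g f) v (p, [ffun u =>
      @K_subst _ _ _ g f (val u) (q (val u), [ffun t => r (val t)])])).
  move=> uv B1 BW HB; apply/mem_K_subst; split=> //.
  have [BE|BE] := eqVneq B' (finset (mem (fib (dC_comp g f) u))).
    by apply: Or32; exists u.
  apply: Or33; exists (exist _ u uv); rewrite ffunE /=; apply/mem_K_subst.
  split=> //; case: HB => [HB|HB|[t Bt]]; [exact: Or31|exact: Or32|apply: Or33].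
  by exists t; rewrite /= ffunE.
case/mem_K_subst => B1; rewrite whole' => BW [[D /= DK BE]|[t tv BE]|[[t tv] /=]].
- case/mem_K_subst: DK => D1 DW [[C /= Cp DE]|[u uv DE]|[[u uv] /=]].
  + apply/mem_K_subst; split=> //; apply: Or31; exists C => //.
    by rewrite BE DE preimset_comp.
  + apply/mem_K_subst; split=> //; apply: Or32; exists u => //.
    by rewrite BE DE !fib_preimset preimset_comp.
  + by rewrite ffunE /= => Dq; apply: (inK u) => //; apply: Or31; exists D.
- have uv : dCmap g t \in fib h v by move: tv; rewrite fib_comp mem_preim.
  by apply: (inK _ _ uv) => //; apply: Or32; exists t; rewrite // mem_fib.
- rewrite ffunE /= => Br.
  have uv : dCmap g t \in fib h v by move: tv; rewrite fib_comp mem_preim.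
  apply: (inK _ _ uv) => //; apply: Or33.
  have tu : t \in fib g (dCmap g t) by rewrite mem_fib.
  by exists (exist _ t tu).
Qed.

(** * From poset identities to the enriched axioms *)

Section Category.
Context (R : realType).

(** Points over propositionally equal morphisms have different types. Presenting both as images of
    one [z] under poset maps with the same underlying bracketings avoids transporting them. *)
Lemma Kfib_eq (S T : cycSet) (f f' : dChom S T) (X : Kfib R f) (X' : Kfib R f') :
  f = f' ->
  (forall t, exists d (A : finPOrderType d) (z : realization R A)
     (phi : A -> K_poset (fib f t)) (phi' : A -> K_poset (fib f' t))
     (phi_mono : {homo phi : a b / (a <= b)%O})
     (phi'_mono : {homo phi' : a b / (a <= b)%O}),
     [/\ X t = realize_map phi_mono z, X' t = realize_map phi'_mono z &
        forall a, val (phi a) = val (phi' a)]) ->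
  existT (fun f : dChom S T => Kfib R f) f X = existT _ f' X'.
Proof.
move=> ff'; subst f' => XX'; congr existT.
apply: functional_extensionality_dep => t.
have [d [A [z [phi [phi' [m [m' [-> -> phiE]]]]]]]] := XX' t.
apply: realization_eq => p; rewrite /weight /= /push_weight.
by apply: eq_bigl => a; rewrite (val_inj (phiE a)).
Qed.

Lemma dCK_id_left (S T : cycSet) (f : dCK_hom R S T) :
  dCK_comp (dCK_id R T) f = f.
Proof.
case: f => f a; rewrite /dCK_comp /=; apply: Kfib_eq => [|u].
  by apply: dChom_eq => t; rewrite fib_comp /fib /= ffunE preim1.
pose x : realization R (K_poset (fib (dC_id T) u)) *
  prod_topology (fun t => realization R (K_poset (fib f t))) :=
  (vertex R (K_empty (fib (dC_id T) u)), a).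
(* A single point [z] of the realized product poset projects to all the data, so only a poset
   identity remains. *)
pose z := realize_prod_inv x; have zE := realize_prod_invK x.
have xE : x.1 = realize_map (@prod_fst_mono _ _ _ _ _) z by rewrite -zE.
have aE t : a t = realize_map (@prod_comp_mono _ _ _ _ _ t) z.
  by rewrite -[a t]/(x.2 t) -zE.
have [psi ->] := realize_map2_realize_map (@K_subst_mono _ _ _ (dC_id T) f u)
  xE (fun t : {t | t \in fib (dC_id T) u} => aE (val t)).
do 7 eexists; split; [by []|exact: aE|move=> [p q]].
exact: (K_subst_id_left p q).
Qed.

Lemma dCK_id_right (S T : cycSet) (f : dCK_hom R S T) :
  dCK_comp f (dCK_id R S) = f.
Proof.
case: f => f a; rewrite /dCK_comp /=; apply: Kfib_eq => [|u].
  apply: dChom_eq => t; rewrite fib_comp; elim: (fib f t) => [//|s C IHC].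
  by rewrite -cat1s preim_cat IHC preim1 /fib /= ffunE.
pose x : realization R (K_poset (fib f u)) *
  prod_topology (fun s => realization R (K_poset (fib (dC_id S) s))) :=
  (a u, fun s => vertex R (K_empty (fib (dC_id S) s))).
pose z := realize_prod_inv x; have zE := realize_prod_invK x.
have xE : a u = realize_map (@prod_fst_mono _ _ _ _ _) z.
  by rewrite -[a u]/(x.1) -zE.
have aE s : vertex R (K_empty (fib (dC_id S) s)) =
    realize_map (@prod_comp_mono _ _ _ _ _ s) z.
  by rewrite -[LHS]/(x.2 s) -zE.
have [psi ->] := realize_map2_realize_map (@K_subst_mono _ _ _ f (dC_id S) u)
  xE (fun t : {t | t \in fib f u} => aE (val t)).
do 7 eexists; split; [by []|exact: xE|move=> [p q]].
exact: (K_subst_id_right p (fun s => q (val s))).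
Qed.

Lemma W_act_id (S : cycSet) (w : cyclohedron R S) : W_act w (dCK_id R S) = w.
Proof.
rewrite /W_act /=.
pose x : realization R (W_poset S) *
  prod_topology (fun s => realization R (K_poset (fib (dC_id S) s))) :=
  (w, fun s => vertex R (K_empty (fib (dC_id S) s))).
pose z := realize_prod_inv x; have zE := realize_prod_invK x.
have xE : w = realize_map (@prod_fst_mono _ _ _ _ _) z.
  by rewrite -[w]/(x.1) -zE.
have aE s : vertex R (K_empty (fib (dC_id S) s)) =
    realize_map (@prod_comp_mono _ _ _ _ _ s) z.
  by rewrite -[LHS]/(x.2 s) -zE.
have [psi ->] := realize_map2_realize_map (@W_subst_mono _ _ (dC_id S)) xE aE.
rewrite [RHS]xE; apply: realization_eq => p; rewrite /weight /= /push_weight.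
by apply: eq_bigl => -[p' q]; rewrite (W_subst_id p' q).
Qed.

Lemma W_act_comp (S T U : cycSet) (g : dCK_hom R T U) (f : dCK_hom R S T)
    (w : cyclohedron R U) : W_act w (dCK_comp g f) = W_act (W_act w g) f.
Proof.
case: g f => g b [f a]; rewrite /W_act /dCK_comp /=.
(* Indexing by [U + T] places [w] and all the [b u] and [a t] in one product, so that one point
   lifts them all. *)
pose Q (i : U + T) : finPOrderType bracketing_display :=
  match i with inl u => K_poset (fib g u) | inr t => K_poset (fib f t) end.
pose x : realization R (W_poset U) * prod_topology (fun i => realization R (Q i))
  := (w, fun i => match i return realization R (Q i) with
                  | inl u => b u | inr t => a t end).
pose z := realize_prod_inv x; have zE := realize_prod_invK x.
have wE : w = realize_map (@prod_fst_mono _ _ _ _ _) z.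
  by rewrite -[w]/(x.1) -zE.
have bE u : b u = realize_map (@prod_comp_mono _ _ _ _ Q (inl u)) z.
  by rewrite -[LHS]/(x.2 (inl u)) -zE.
have aE t : a t = realize_map (@prod_comp_mono _ _ _ _ Q (inr t)) z.
  by rewrite -[LHS]/(x.2 (inr t)) -zE.
(* The composed component over [u] is again an image of [z], which lets the outer substitution be
   computed from [z] as well. *)
have gf u := cid (realize_map2_realize_map (@K_subst_mono _ _ _ g f u) (bE u)
  (fun t : {t | t \in fib g u} => aE (val t))).
have [psi ->] := realize_map2_realize_map (@W_subst_mono _ _ (dC_comp g f))
  wE (fun u => svalP (gf u)).
have [psi' wgE] := realize_map2_realize_map (@W_subst_mono _ _ g) wE bE.
have [psi'' ->] := realize_map2_realize_map (@W_subst_mono _ _ f) wgE aE.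
apply: realization_eq => p; rewrite /weight /= /push_weight.
apply: eq_bigl => -[p' q].
by rewrite /= (W_subst_assoc p' (fun u => q (inl u)) (fun t => q (inr t))).
Qed.

Lemma dCK_comp_assoc (S T U V : cycSet) (h : dCK_hom R U V) (g : dCK_hom R T U)
    (f : dCK_hom R S T) :
  dCK_comp h (dCK_comp g f) = dCK_comp (dCK_comp h g) f.
Proof.
case: h g f => h c [g b] [f a]; rewrite /dCK_comp /=; apply: Kfib_eq => [|v].
  by apply: dChom_eq => v; rewrite !fib_comp preim_comp.
pose Q (i : U + T) : finPOrderType bracketing_display :=
  match i with inl u => K_poset (fib g u) | inr t => K_poset (fib f t) end.
pose x : realization R (K_poset (fib h v)) *
    prod_topology (fun i => realization R (Q i))
  := (c v, fun i => match i return realization R (Q i) with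
                    | inl u => b u | inr t => a t end).
pose z := realize_prod_inv x; have zE := realize_prod_invK x.
have cE : c v = realize_map (@prod_fst_mono _ _ _ _ _) z.
  by rewrite -[c v]/(x.1) -zE.
have bE u : b u = realize_map (@prod_comp_mono _ _ _ _ Q (inl u)) z.
  by rewrite -[LHS]/(x.2 (inl u)) -zE.
have aE t : a t = realize_map (@prod_comp_mono _ _ _ _ Q (inr t)) z.
  by rewrite -[LHS]/(x.2 (inr t)) -zE.
have gf u := cid (realize_map2_realize_map (@K_subst_mono _ _ _ g f u) (bE u)
  (fun t : {t | t \in fib g u} => aE (val t))).
have [psi ->] := realize_map2_realize_map
  (@K_subst_mono _ _ _ h (dC_comp g f) v)
  cE (fun u : {u | u \in fib h v} => svalP (gf (val u))).
have [psi' hgE] := realize_map2_realize_map (@K_subst_mono _ _ _ h g v) cE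
  (fun u : {u | u \in fib h v} => bE (val u)).
have [psi'' ->] := realize_map2_realize_map
  (@K_subst_mono _ _ _ (dC_comp h g) f v) hgE
  (fun t : {t | t \in fib (dC_comp h g) v} => aE (val t)).
do 7 eexists; split; [by []|by []|move=> [p q]].
exact: (K_subst_assoc p (fun u => q (inl u)) (fun t => q (inr t))).
Qed.

Lemma Kfib_compact_hausdorff (S T : cycSet) (f : dChom S T) :
  compact_hausdorff (Kfib R f).
Proof.
split; first by apply: prod_topology_compact => t; exact: realization_compact.
by apply: hausdorff_product => t; exact: realization_hausdorff.
Qed.

(** A set is open in the coproduct when its traces on all summands are, and each summand, being
    compact Hausdorff, is itself a test space. Since the coproduct is Hausdorff, compact images in
    it are closed. *)
Lemma dCK_hom_cgwh (S T : cycSet) : cgwh (dCK_hom R S T).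
Proof.
split=> [A cA|C h [cC _] ch].
  rewrite -openC; apply/sigT_openP => f; rewrite preimage_setC openC.
  by apply: cA; [exact: Kfib_compact_hausdorff|exact: existT_continuous].
apply: compact_closed.
  by apply: sigT_hausdorff => f; have [] := Kfib_compact_hausdorff f.
by apply: continuous_compact => //; exact: continuous_subspaceT.
Qed.

(** On a pair of summands, the component over [u] restricts the families to the fiber over [u] and
    then applies a continuous [realize_map2]. *)
Lemma dCK_comp_continuous (S T U : cycSet) :
  continuous (fun gf : dCK_hom R T U * dCK_hom R S T => dCK_comp gf.1 gf.2).
Proof.
apply: sigT_pair_continuous => g f x; rewrite /dCK_comp /=.
apply: (@continuous_comp _ _ _ _ (existT _ (dC_comp g f))); last first.
  exact: existT_continuous.
apply: (@prod_topology_continuous _ _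
  (fun u => assoc R (fib (dC_comp g f) u))) => u {}x.
apply: (@continuous_comp _ _ _ (fun ba : Kfib R g * Kfib R f =>
  (ba.1 u, fun t : {t | t \in fib g u} => ba.2 (val t))
   : _ * prod_topology (fun t : {t | t \in fib g u} => assoc R (fib f (val t))))).
  apply: (@cvg_pair _ _ _ (nbhs x) (nbhs _) (nbhs _)).
    apply: (@continuous_comp _ _ _ fst (fun b : Kfib R g => b u)).
      exact: cvg_fst.
    exact: (@proj_continuous _ (fun u => assoc R (fib g u))).
  apply: (@prod_topology_continuous _ _
    (fun t : {t | t \in fib g u} => assoc R (fib f (val t)))) => t {}x.
  apply: (@continuous_comp _ _ _ snd (fun a : Kfib R f => a (val t))).
    exact: cvg_snd.
  exact: (@proj_continuous _ (fun u => assoc R (fib f u))).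
exact: realize_map2_continuous.
Qed.

Lemma W_act_continuous (S T : cycSet) :
  continuous (fun wf : cyclohedron R T * dCK_hom R S T => W_act wf.1 wf.2).
Proof.
apply: pair_sigT_continuous => f x.
apply: (@continuous_comp _ _ _ (fun wa => (wa.1, wa.2))
  (realize_map2 (R := R) (@W_subst_mono S T f))).
  by apply: (@cvg_pair _ _ _ (nbhs x) (nbhs _) (nbhs _));
    [exact: cvg_fst|exact: cvg_snd].
exact: realize_map2_continuous.
Qed.

Lemma dCK_is_top_category : is_top_category (@dCK_id R) (@dCK_comp R).
Proof.
split; [exact: dCK_hom_cgwh| |exact: dCK_id_left|exact: dCK_id_right|
  exact: dCK_comp_assoc].
by move=> S T U; apply: continuous_k_continuous; exact: dCK_comp_continuous.
Qed.

Lemma W_is_top_presheaf :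
  is_top_presheaf (@dCK_id R) (@dCK_comp R) (@W_act R).
Proof.
split; [|move=> S T|exact: W_act_id|exact: W_act_comp].
  move=> S; apply: compact_hausdorff_cgwh; split.
    exact: realization_compact.
  exact: realization_hausdorff.
by apply: continuous_k_continuous; exact: W_act_continuous.
Qed.

End Category.

Theorem theorem4p9 (R : realType) :
  (forall (n : nat) (S : cycSet), (1 <= n)%N -> #|S| = n ->
     homeomorphic (cyclohedron R S) (closed_disc R n.-1)) /\
  is_top_category (@dCK_id R) (@dCK_comp R) /\
  is_top_presheaf (@dCK_id R) (@dCK_comp R) (@W_act R).
Proof.
split; first by move=> n S n_gt0 Sn; rewrite -Sn; apply: homeomorphic_cyclohedron;
  rewrite Sn.
by split; [exact: dCK_is_top_category|exact: W_is_top_presheaf].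
Qed.
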